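(* Let $R$ be a unital Banach algebra with norm $\|\cdot\|$ and identity $I$. Let $A,B,Z\in R$ be (in general noncommuting) parameters and let $Q\in R$ be the base. Suppose that $Q$ and $B$ both commute with each of the other parameters (while $A$ and $Z$ need not commute with each other). Assume that $\|Z\|<1$ and $\|BZ^{-1}A^{-1}\|<1$. Then the following two summations hold. (Type I) $$ {}_1\psi_1\!\left\lceil\!\begin{array}{c}A\\ B\end{array}\!;Q,Z\right\rfloor= \left\lfloor\!\begin{array}{c}Q,\;BZ^{-1}A^{-1}Z\\ B,\;BZ^{-1}A^{-1}\end{array}\!;Q,I\right\rceil_\infty \left\lceil\!\begin{array}{c}Z^{-1}A^{-1}Q\\ Z^{-1}A^{-1}ZQ\end{array}\!;Q,I\right\rfloor_\infty \left\lfloor\!\begin{array}{c}AZ\\ Z\end{array}\!;Q,I\right\rceil_\infty . $$ (Type II) $$ {}_1\psi_1\!\left\lfloor\!\begin{array}{c}A\\ B\end{array}\!;Q,Z\right\rceil= {}^{\sim}\!\left\lfloor\!\begin{array}{c}AZ\\ Z\end{array}\!;Q,I\right\rceil_\infty \left\lfloor\!\begin{array}{c}Z^{-1}A^{-1}Q,\;Q\\ B,\;A^{-1}Q\end{array}\!;Q,I\right\rceil_\infty {}^{\sim}\!\left\lfloor\!\begin{array}{c}BA^{-1}\\ BZ^{-1}A^{-1}\end{array}\!;Q,I\right\rceil_\infty . $$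
   Context: $R$ is a unital Banach algebra with norm $\|\cdot\|$ and identity $I$; its elements do not commute in general. The base $Q\in R$ commutes with all other parameters that appear (for instance $Q=qI$, $q$ a scalar). All expressions that appear are implicitly assumed to be well defined; in particular, whenever an inverse $X^{-1}$ is written (also inside the definitions below, including the products with negative index and the negative powers of $Q$ in them), its existence is assumed. Ordered products. For integers $l,m$, $$\prod_{j=l}^m X_j=\begin{cases} I & m=l-1,\\ X_lX_{l+1}\cdots X_m & m\ge l,\\ X_{l-1}^{-1}X_{l-2}^{-1}\cdots X_{m+1}^{-1} & m<l-1.\end{cases}$$ Products $\prod_{i=1}^r$ are ordered in the same way, with $i$ increasing from left to right. Noncommutative $Q$-shifted factorials. For an integer $k$ (possibly negative): type I: $$\left\lceil\!\begin{array}{c}A_1,\dots,A_r\\ B_1,\dots,B_r\end{array}\!;Q,Z\right\rfloor_k=\prod_{j=1}^k\left[\left(\prod_{i=1}^r(I-B_iQ^{k-j})^{-1}(I-A_iQ^{k-j})\right)Z\right];$$ type II: $$\left\lfloor\!\begin{array}{c}A_1,\dots,A_r\\ B_1,\dots,B_r\end{array}\!;Q,Z\right\rceil_k=\prod_{j=1}^k\left[\left(\prod_{i=1}^r(I-B_iQ^{j-1})^{-1}(I-A_iQ^{j-1})\right)Z\right];$$ reversed type II: $${}^{\sim}\!\left\lfloor\!\begin{array}{c}A_1,\dots,A_r\\ B_1,\dots,B_r\end{array}\!;Q,Z\right\rceil_k=\prod_{j=1}^k\left(Z\prod_{i=1}^r(I-A_iQ^{k-j})(I-B_iQ^{k-j})^{-1}\right).$$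 For $k=\infty$ these denote the limits in $R$ as $k\to\infty$ of the corresponding expressions. Noncommutative bilateral basic hypergeometric series of type I and type II: $${}_1\psi_1\!\left\lceil\!\begin{array}{c}A\\ B\end{array}\!;Q,Z\right\rfloor=\sum_{k=-\infty}^{\infty}\left\lceil\!\begin{array}{c}A\\ B\end{array}\!;Q,Z\right\rfloor_k,\qquad {}_1\psi_1\!\left\lfloor\!\begin{array}{c}A\\ B\end{array}\!;Q,Z\right\rceil=\sum_{k=-\infty}^{\infty}\left\lfloor\!\begin{array}{c}A\\ B\end{array}\!;Q,Z\right\rceil_k .$$ *)

(* Defs.v *)
From HB Require Import structures.
From mathcomp Require Import all_boot all_order all_algebra.
From mathcomp Require Import all_classical all_reals all_analysis.

Set Implicit Arguments.
Unset Strict Implicit.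
Unset Printing Implicit Defensive.

Import Order.TTheory GRing.Theory Num.Theory.
Import numFieldNormedType.Exports.

Local Open Scope classical_set_scope.
Local Open Scope ring_scope.

(* A (nonzero) Banach algebra. Only the norm, the topology and the ring
   structure are used below, so real scalars suffice: a complex Banach algebra
   is a real one by restriction of scalars. The normalization `|1| = 1 is not
   required.
   The multiplication is given as an operation on a complete normed module,
   because Hierarchy Builder rejects a structure joining NormedModule and NzRing
   (NumDomain already inherits from both semi-normed Z-modules and rings). The
   usual ring and algebra structures are then attached to the carrier. *)
HB.mixin Record NormedModule_hasBanachMul (R : realType) V
    & NormedModule R V := {
  bone : V;
  bmul : V -> V -> V;
  bmulA : associative bmul;
  bmul1r : left_id bone bmul;
  bmulr1 : right_id bone bmul;
  bmulDl : left_distributive bmul +%R;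
  bmulDr : right_distributive bmul +%R;
  bscaleAl : forall (a : R) (x y : V), a *: bmul x y = bmul (a *: x) y;
  bscaleAr : forall (a : R) (x y : V), a *: bmul x y = bmul x (a *: y);
  bone_neq0 : bone != 0;
  ler_norm_bmul : forall x y : V, `|bmul x y| <= `|x| * `|y|
}.

#[short(type="banachAlgType")]
HB.structure Definition BanachAlgebra (R : realType) :=
  {V of CompleteNormedModule R V & NormedModule_hasBanachMul R V}.

Section BanachAlgebraRing.
Variables (R : realType) (V : banachAlgType R).

HB.instance Definition _ := GRing.Zmodule_isNzRing.Build (BanachAlgebra.sort V)
  bmulA bmul1r bmulr1 bmulDl bmulDr bone_neq0.
HB.instance Definition _ :=
  GRing.Lmodule_isLalgebra.Build R (BanachAlgebra.sort V) bscaleAl.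
HB.instance Definition _ :=
  GRing.Lalgebra_isAlgebra.Build R (BanachAlgebra.sort V) bscaleAr.

Lemma ler_normM (x y : V) : `|x * y| <= `|x| * `|y|.
Proof. exact: ler_norm_bmul. Qed.

(* Units are the two-sided invertible elements; the inverse of a non-unit x is x
   itself, as required by [unitRingType]. *)
Let has_inv (x : V) : Prop := exists y : V, y * x = 1 /\ x * y = 1.
Let bunit : pred V := fun x => `[< has_inv x >].
Let binv (x : V) : V :=
  if pselect (has_inv x) is left h then projT1 (cid h) else x.

Let binvP x : bunit x -> binv x * x = 1 /\ x * binv x = 1.
Proof.
move=> /asboolP hx; rewrite /binv; case: pselect => // h.
by case: (cid h).
Qed.

Let bmulVr : {in bunit, left_inverse 1 binv *%R}.
Proof. by move=> x /binvP[]. Qed.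

Let bdivrr : {in bunit, right_inverse 1 binv *%R}.
Proof. by move=> x /binvP[]. Qed.

Let bunitP (x y : V) : y * x = 1 /\ x * y = 1 -> bunit x.
Proof. by move=> h; apply/asboolP; exists y. Qed.

Let binv_out : {in [predC bunit], binv =1 id}.
Proof. by move=> x /asboolPn hx; rewrite /binv; case: pselect. Qed.

HB.instance Definition _ :=
  GRing.NzRing_hasMulInverse.Build (BanachAlgebra.sort V)
    bmulVr bdivrr bunitP binv_out.

End BanachAlgebraRing.

Section OrderedProduct.
Variable V : unitRingType.

(* The product of the X j for j from l to m, increasing from left to right.
   If m - l + 1 = - n.+1 < 0, it is the product of the n.+1 = l - 1 - m
   inverses (X (l - 1))^-1 * (X (l - 2))^-1 * ... * (X (m + 1))^-1. *)
Definition oprod (l m : int) (X : int -> V) : V :=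
  match m - l + 1 with
  | Posz n => \prod_(i < n) X (l + i%:Z)
  | Negz n => \prod_(i < n.+1) (X (l - 1 - i%:Z))^-1
  end.

Variable r : nat.
Implicit Types (A B : r.-tuple V) (Q Z : V) (k : int).

Definition qfactI A B Q Z k : V :=
  oprod 1 k (fun j =>
    (\prod_(i < r) ((1 - tnth B i * Q ^ (k - j))^-1 *
                    (1 - tnth A i * Q ^ (k - j)))) * Z).

Definition qfactII A B Q Z k : V :=
  oprod 1 k (fun j =>
    (\prod_(i < r) ((1 - tnth B i * Q ^ (j - 1))^-1 *
                    (1 - tnth A i * Q ^ (j - 1)))) * Z).

Definition rev_qfactII A B Q Z k : V :=
  oprod 1 k (fun j =>
    Z * \prod_(i < r) ((1 - tnth A i * Q ^ (k - j)) *
                       (1 - tnth B i * Q ^ (k - j))^-1)).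

End OrderedProduct.

Section Limits.
Variables (R : realType) (V : banachAlgType R).
Implicit Types f : int -> V.

Definition cvg_infty f : Prop := cvgn (fun n : nat => f n%:Z).
Definition at_infty f : V := limn (fun n : nat => f n%:Z).

(* A bilateral series converges when both of its halves, over k >= 0 and over
   k < 0, do. *)
Definition cvg_bilateral f : Prop :=
  cvgn (series (fun n : nat => f n%:Z)) /\
  cvgn (series (fun n : nat => f (- n.+1%:Z))).
Definition bilateral_sum f : V :=
  limn (series (fun n : nat => f n%:Z)) +
  limn (series (fun n : nat => f (- n.+1%:Z))).

Definition psi11I (A B Q Z : V) : V :=
  bilateral_sum (qfactI [tuple A] [tuple B] Q Z).
Definition psi11II (A B Q Z : V) : V :=
  bilateral_sum (qfactII [tuple A] [tuple B] Q Z).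

End Limits.

(* Main.v *)
Require Import Defs.
From HB Require Import structures.
From mathcomp Require Import all_boot all_order all_algebra.
From mathcomp Require Import all_classical all_reals all_analysis.
From mathcomp Require Import ring lra.

Set Implicit Arguments.
Unset Strict Implicit.
Unset Printing Implicit Defensive.

Import Order.TTheory GRing.Theory Num.Theory.
Import numFieldNormedType.Exports.

Local Open Scope classical_set_scope.
Local Open Scope ring_scope.

(* Write U = Z^-1 A^-1 and let f(B) be the type I series. Its terms t_k satisfy
   (1 - B) t_k(B) = (1 - B Q^k) t_k(BQ) and
   (1 - B) t_{k+1}(B) = (1 - A Q^k) Z t_k(BQ), hence
     (1 - B) (1 - BU) f(B) = (1 - BUZ) f(BQ),
   the noncommutative form of the equation of Andrews and Askey. Iterating it
   expresses f(B) through lim f(BQ^N) = f(0). Started at B = Q, where f(Q) is the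
   Q-binomial series, the same equation computes f(Q^(N+1)), which also tends to
   f(0); this gives f(0) without analytic continuation in B. The type II sum is
   the type I sum in the opposite algebra, with Z^-1 A Z in place of A. *)

(** The obstacle is the order of the factors: [U] and [U Z] need not commute, so the side on which
    the functional equation adds a factor matters. Solved for f(B) it adds factors on the right,
    solved for f(BQ) on the left. Up to factors in B and Q alone, which commute with everything,
    iteration from B gives the first product of the type I formula, iteration from Q the second,
    already in type I order, and the binomial sum f(Q) the third. Starting at Q needs no bound on Q
    U, because the negative half is then a finite sum. Both passages to f(0) are dominated
    convergence with majorants uniform in N: a quotient of Pochhammer products for indices >= 0, the
    smallness of B Q^N for indices < 0. Smallness of Q, Z and B U enters only as convergence of
    their powers to 0; a series whose term ratios tend to such an element converges absolutely.
    Replacing A by Z^-1 A Z in the opposite algebra leaves U unchanged, hence also the condition on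
    B U. *)

Section RealSeries.
Variable R : realType.
Implicit Types s e : nat -> R.

Lemma series_ubound_cvg s M :
  (forall n, 0 <= s n) -> (forall n, series s n <= M) -> cvgn (series s).
Proof.
move=> s0 sM; apply: nondecreasing_is_cvgn.
  by apply: nondecreasing_series => n _ _; exact: s0.
by exists M => _ [n _ <-]; exact: sM.
Qed.

(* Partial sums [S] from [n0] on satisfy [S n <= S m + S n / 2]. *)
Lemma series_halving_cvg s m n0 : (forall n, 0 <= s n) ->
  (forall n, (n0 <= n)%N -> s (n + m)%N <= 2^-1 * s n) -> cvgn (series s).
Proof.
move=> s0 sm; pose s' k := s (k + n0)%N.
have ler_series n n' : (n <= n')%N -> series s' n <= series s' n'.
  by move=> nn'; apply: nondecreasing_series => // k _ _; exact: s0.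
have s'M n : series s' n <= 2 * series s' m.
  have le1 : series s' n <= series s' m + 2^-1 * series s' n.
    apply: (le_trans (ler_series n (n + m)%N (leq_addr _ _))).
    rewrite series_addn lerD2l (big_addn 0 (n + m) m) addnK mulr_sumr.
    by apply: ler_sum => k _; rewrite /s' addnAC; apply: sm; exact: leq_addl.
  lra.
apply: (@series_ubound_cvg _ (series s n0 + 2 * series s' m)) => // n.
apply: (@le_trans _ _ (series s (n + n0)%N)).
  by apply: nondecreasing_series; [move=> k _ _; exact: s0 | exact: leq_addr].
by rewrite series_addn lerD2l (big_addn 0 (n + n0) n0) addnK; exact: s'M.
Qed.

End RealSeries.

(** * Limits, absolute convergence and dominated convergence in a Banach algebra *)

Section BanachAlgebraSequences.
Variables (R : realType) (V : banachAlgType R).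
Implicit Types (u v P p : nat -> V) (x a b : V).

Lemma cvgn_norm_bounded u : cvgn u -> exists2 M, 0 < M & forall n, `|u n| <= M.
Proof.
move=> /cvg_seq_bounded /pinfty_ex_gt0 [M M0 uM]; exists M => // n.
exact: uM.
Qed.

Lemma cvg_norm_le0 u (e : nat -> R) :
  (forall n, `|u n| <= e n) -> e @ \oo --> (0 : R) -> u @ \oo --> (0 : V).
Proof.
move=> ue e0; apply/norm_cvg0P; apply: (squeeze_cvgr _ (cvg_cst 0) e0).
by apply: nearW => n; rewrite normr_ge0 ue.
Qed.

Lemma cvg_mul u v a b :
  u @ \oo --> a -> v @ \oo --> b -> (fun n => u n * v n) @ \oo --> a * b.
Proof.
move=> ua vb; have [M M0 uM] := cvgn_norm_bounded (cvgP _ ua).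
apply/subr_cvg0.
apply: (@cvg_norm_le0 _ (fun n => `|u n - a| * `|b| + M * `|v n - b|)).
  move=> n; rewrite -[_ - _](_ : u n * (v n - b) + (u n - a) * b = _).
    rewrite addrC (le_trans (ler_normD _ _))// lerD ?ler_normM//.
    by rewrite (le_trans (ler_normM _ _))// ler_wpM2r.
  by rewrite mulrBr mulrBl addrA subrK.
rewrite -[0](_ : `|a - a| * `|b| + M * `|b - b| = _); last first.
  by rewrite !subrr normr0 mul0r mulr0 addr0.
by apply: cvgD; apply: cvgM; (try exact: cvg_cst); apply: cvg_norm;
  apply: cvgB => //; exact: cvg_cst.
Qed.

Lemma limn_mul u v : cvgn u -> cvgn v ->
  limn (fun n => u n * v n) = limn u * limn v.
Proof. by move=> cu cv; apply: cvg_lim => //; exact: cvg_mul. Qed.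

Lemma is_cvg_mul u v : cvgn u -> cvgn v -> cvgn (fun n => u n * v n).
Proof. by move=> cu cv; apply: cvgP (cvg_mul cu cv). Qed.

Lemma cvg_mull x u a : u @ \oo --> a -> (fun n => x * u n) @ \oo --> x * a.
Proof. by apply: cvg_mul; exact: cvg_cst. Qed.

Lemma cvg_mulr x u a : u @ \oo --> a -> (fun n => u n * x) @ \oo --> a * x.
Proof. by move=> ua; apply: cvg_mul => //; exact: cvg_cst. Qed.

(* A power of [x] has norm less than 1/2, and sufficiently far out so has the
   product of that many consecutive factors [u n]. *)
Lemma contracting_product_cvg u x p :
  u @ \oo --> x -> (fun k => x ^+ k) @ \oo --> (0 : V) ->
  (forall n, p n.+1 = u n * p n) -> cvgn (series (fun n => `|p n|)).
Proof.
move=> ux x0 pS.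
have [m xm] : exists m, `|x ^+ m| < 2^-1.
  have /cvgr0Pnorm_lt/(_ 2^-1) := x0; rewrite invr_gt0 ltr0n => /(_ isT).
  by move=> [m _ /(_ m (leqnn _))]; exists m.
pose b := fix b k n := if k is k'.+1 then u (n + k')%N * b k' n else 1.
have bP k n : p (n + k)%N = b k n * p n.
  elim: k => [|k IH] /=; first by rewrite addn0 mul1r.
  by rewrite addnS pS IH mulrA.
have bx k : b k @ \oo --> x ^+ k.
  elim: k => [|k IH]; first by rewrite expr0; exact: cvg_cst.
  by rewrite exprS; apply: cvg_mul => //; apply: cvg_comp ux; exact: cvg_addnr.
have /cvg_norm/cvgr_lt/(_ _ xm) := bx m.
move=> [n0 _ bn]; apply: (@series_halving_cvg _ _ m n0) => // n nn0.
rewrite bP (le_trans (ler_normM _ _))// ler_wpM2r//.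
exact/ltW/bn.
Qed.

End BanachAlgebraSequences.

Section BanachAlgebraLimits.
Variables (R : realType) (V : banachAlgType R).
Implicit Types (u v P p : nat -> V) (x a b : V).

Lemma is_cvg_norm_series u (w : nat -> R) : (forall n, `|u n| <= w n) ->
  cvgn (series w) -> cvgn (series u).
Proof.
move=> uw cw; apply: normed_cvg; apply: series_le_cvg cw => // n.
  exact: normr_ge0.
exact: le_trans (normr_ge0 _) (uw n).
Qed.

Lemma norm_limn_le u (M : R) : cvgn u -> (forall n, `|u n| <= M) ->
  `|limn u| <= M.
Proof.
move=> cu uM; rewrite -lim_norm//; apply: limr_le.
  by apply: is_cvg_norm.
exact: nearW.
Qed.

Lemma limn_series_sub u v : cvgn (series u) -> cvgn (series v) ->
  limn (series (fun n => u n - v n)) = limn (series u) - limn (series v).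
Proof.
move=> cu cv; rewrite -limB//; congr (limn _); apply/funext => n.
by rewrite seriesEnat /= sumrB.
Qed.

Lemma cvg_sum0 (u : nat -> nat -> R) n :
  (forall k, u ^~ k @ \oo --> (0 : R)) ->
  (fun N => \sum_(0 <= k < n) u N k) @ \oo --> (0 : R).
Proof.
move=> u0; elim: n => [|n IH].
  by under eq_fun do rewrite big_nil; exact: cvg_cst.
under eq_fun do rewrite big_nat_recr//=.
have := cvgD IH (u0 n); rewrite addr0; exact.
Qed.

(** Dominated convergence for series. The limit terms inherit the bound, so beyond [n0] the
    difference costs at most twice the tail of [w]; the finitely many terms before [n0] converge one
    by one. The bound is asked only from [N1] on because the majorant of the negative half holds
    only once [B * Q ^+ N] is small. *)
Lemma tannery (u : nat -> nat -> V) (w : nat -> R) (l : nat -> V) N1 :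
  (forall N n, (N1 <= N)%N -> `|u N n| <= w n) -> cvgn (series w) ->
  (forall n, u ^~ n @ \oo --> l n) ->
  cvgn (series l) /\
  (fun N => limn (series (u N))) @ \oo --> limn (series l).
Proof.
move=> uw cw ul.
have lw n : `|l n| <= w n.
  rewrite -(cvg_lim _ (ul n))// -lim_norm; last exact: cvgP (ul n).
  apply: limr_le; first exact: is_cvg_norm (cvgP _ (ul n)).
  by exists N1 => // N /= /uw.
have cl : cvgn (series l) by exact: is_cvg_norm_series cw.
split=> //; apply/cvgrPdist_lt => e e0.
have w0 n : 0 <= w n by exact: le_trans (normr_ge0 _) (lw n).
have cu N : (N1 <= N)%N -> cvgn (series (u N)).
  by move=> N1N; apply: is_cvg_norm_series cw => n; exact: uw.
(* Twice this tail stays below e / 2, and the head gets the other half. *)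
have [n0 _ wn0] : \forall n \near \oo, `|limn (series w) - series w n| < e / 4.
  by move/cvgrPdist_lt : cw => /(_ (e / 4)); apply; rewrite divr_gt0.
have {}wn0 := wn0 n0 (leqnn _).
have : (fun N => \sum_(0 <= k < n0) `|l k - u N k|) @ \oo --> (0 : R).
  apply: (@cvg_sum0 (fun N k => `|l k - u N k|)) => k.
  apply/norm_cvg0P; rewrite -(subrr (l k)).
  by apply: cvgB; [exact: cvg_cst | exact: ul].
move=> /cvgr_lt/(_ (e / 2)); rewrite divr_gt0// => /(_ isT) [N2 _ uN2].
exists (maxn N1 N2) => // N /=; rewrite geq_max => /andP[N1N N2N].
rewrite -limn_series_sub//; last exact: cu.
apply: (@le_lt_trans _ _
  (\sum_(0 <= k < n0) `|l k - u N k| + 2 * (limn (series w) - series w n0))).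
  apply: norm_limn_le.
    apply: (@is_cvg_norm_series _ (fun n => w n + w n)).
      by move=> n; rewrite (le_trans (ler_normB _ _))// lerD// uw.
    exact: is_cvg_seriesD.
  move=> n; apply: le_trans (ler_norm_sum _ _ _) _.
  apply: (@le_trans _ _ (\sum_(0 <= k < n0 + n) `|l k - u N k|)).
    exact: (nondecreasing_series (fun k _ _ => normr_ge0 _)) (leq_addl _ _).
  rewrite (big_cat_nat (leq0n n0) (leq_addr _ _))//= lerD2l.
  apply: (@le_trans _ _ (\sum_(n0 <= k < n0 + n) (w k * 2))).
    apply: ler_sum => k _; rewrite mulr_natr mulr2n.
    by rewrite (le_trans (ler_normB _ _))// lerD// uw.
  rewrite -mulr_suml mulrC ler_wpM2l// -sub_series_geq ?leq_addr// lerB//.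
  apply: nondecreasing_cvgn_le => //.
  by apply: nondecreasing_series.
have := uN2 N N2N; move: wn0 => /ltr_normlW; rewrite /=.
move: (limn _ - _) (\sum_(_ <= _ < _) _) => r s; lra.
Qed.

(** Since 1 + e <= exp e, the norms of [P] stay below |P 0| times the exponential of the sum of [e].
    The increments are then dominated by a multiple of [e], and [P] is recovered by telescoping.
    Only increments enter, so products growing on either side are covered. *)
Lemma cvg_product_of_increments P (e : nat -> R) : (forall n, 0 <= e n) ->
  (forall n, `|P n.+1 - P n| <= e n * `|P n|) -> cvgn (series e) -> cvgn P.
Proof.
move=> e0 Pe ce; have ub n : series e n <= limn (series e).
  by apply: nondecreasing_cvgn_le => //; exact: nondecreasing_series.
have PM n : `|P n| <= `|P 0%N| * expR (series e n).
  elim: n => [|n IH]; first by rewrite seriesEnat /= big_nil expR0 mulr1.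
  rewrite seriesSr expRD mulrA -[P n.+1](subrK (P n)).
  apply: le_trans (ler_normD _ _) _.
  apply: (@le_trans _ _ (`|P n| * (1 + e n))).
    by rewrite mulrDr mulr1 addrC lerD2l mulrC.
  by rewrite ler_pM// ?expR_ge1Dx// addr_ge0.
have ct : cvgn (series (telescope P)).
  apply: (@is_cvg_norm_series _
    ((`|P 0%N| * expR (limn (series e))) *: e)); last exact: is_cvg_seriesZ.
  move=> n; rewrite /telescope; apply: le_trans (Pe n) _.
  rewrite [leRHS]mulrC ler_wpM2l//; apply: le_trans (PM n) _.
  by rewrite ler_wpM2l// ler_expR.
have PE : P = (fun n => P 0%N + series (telescope P) n).
  by apply/funext => n; exact: eq_sum_telescope.
have : cvgn (fun n => P 0%N + series (telescope P) n).
  exact: cvgP (cvgD (cvg_cst (P 0%N)) ct).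
by rewrite -PE.
Qed.

(** Once |1 - u| < 1/2, the estimate |u^-1| <= |1| + |u^-1| |1 - u| can be absorbed into |u^-1| <= 2
    |1|, which gives |u^-1 - 1| <= 2 |1| |1 - u|. *)
Lemma cvg_inv1 u : (forall n, u n \is a GRing.unit) -> u @ \oo --> (1 : V) ->
  (fun n => (u n)^-1) @ \oo --> (1 : V).
Proof.
move=> uU u1; apply/subr_cvg0/norm_cvg0P.
have d0 : (fun n => `|1 - u n|) @ \oo --> (0 : R).
  apply/norm_cvg0P; rewrite -(subrr 1); apply: cvgB => //; exact: cvg_cst.
have ub n : `|1 - u n| < 2^-1 -> `|(u n)^-1 - 1| <= (2 * `|1 : V|) * `|1 - u n|.
  move=> un; have uE : (u n)^-1 - 1 = (u n)^-1 * (1 - u n).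
    by rewrite mulrBr mulr1 mulVr.
  have le1 : `|(u n)^-1 - 1| <= `|(u n)^-1| * `|1 - u n|.
    by rewrite uE ler_normM.
  apply: (le_trans le1); rewrite ler_wpM2r//.
  have le2 : `|(u n)^-1| <= `|1 : V| + `|(u n)^-1 - 1|.
    by rewrite -[X in `|X| <= _](subrK 1) addrC ler_normD.
  have le3 : `|(u n)^-1| * `|1 - u n| <= `|(u n)^-1| * 2^-1.
    by rewrite ler_wpM2l// ltW.
  by lra.
have d0' : (fun n => (2 * `|1 : V|) * `|1 - u n|) @ \oo --> (0 : R).
  by rewrite -[0](mulr0 (2 * `|1 : V|)); apply: cvgM => //; exact: cvg_cst.
apply: (squeeze_cvgr _ (cvg_cst 0) d0').
have /cvgr_lt/(_ 2^-1) := d0; rewrite invr_gt0 ltr0n => /(_ isT).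
by apply: filterS => n /ub ->; rewrite normr_ge0.
Qed.

(** Neumann series: it converges absolutely as soon as the powers of [x] tend to 0, even if |x| >=
    1, and it commutes with [x], so it is an inverse on both sides. *)
Lemma unit_sub1 x : (fun n => x ^+ n) @ \oo --> (0 : V) ->
  1 - x \is a GRing.unit.
Proof.
move=> x0; pose s := series (fun n => x ^+ n).
have cs : cvgn s.
  apply: (normed_cvg (u_ := fun n => x ^+ n)).
  by apply: (@contracting_product_cvg _ _ (fun=> x) x) => //;
    [exact: cvg_cst | exact: exprS].
have sE n : (1 - x) * s n = 1 - x ^+ n.
  rewrite /s seriesEnat /= big_mkord -opprB mulNr -subrX1 opprB; congr (_ - _).
have xs n : x * s n = s n * x.
  rewrite /s seriesEnat /= mulr_sumr mulr_suml.
  by apply: eq_bigr => i _; rewrite -exprS exprSr.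
have lim1 : (fun n => 1 - x ^+ n) @ \oo --> (1 : V).
  by rewrite -[X in _ --> X]subr0; apply: cvgB => //; exact: cvg_cst.
have e1 : (1 - x) * limn s = 1.
  have := @cvg_mull _ _ (1 - x) _ _ cs; under eq_fun do rewrite sE.
  by move=> /cvg_lim <-//; exact: cvg_lim.
have e2 : limn s * (1 - x) = 1.
  have := @cvg_mulr _ _ (1 - x) _ _ cs.
  under eq_fun do rewrite mulrBr mulr1 -xs -[X in X - _]mul1r -mulrBl sE.
  by move=> /cvg_lim <-//; exact: cvg_lim.
by apply/unitrP; exists (limn s).
Qed.

End BanachAlgebraLimits.

(** * Infinite products whose factors tend to 1 at the rate of the powers of Q *)

Section NearOne.
Variables (R : realType) (V : banachAlgType R) (Q : V).
Hypothesis Q0 : (fun n => Q ^+ n) @ \oo --> (0 : V).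
Implicit Types (u v P : nat -> V) (x : V).

(** A class of factors stable under product, shift and inverse. As the norms of the powers of [Q]
    are summable, infinite products of such factors converge, whichever side new factors are added
    on. *)
Definition near_one u : Prop :=
  exists2 C : R, 0 <= C & forall n, `|u n - 1| <= C * `|Q ^+ n|.

Lemma cvg_norm_series_expr : cvgn (series (fun n => `|Q ^+ n|)).
Proof.
by apply: (contracting_product_cvg (u := fun=> Q) (x := Q)) => //;
  [exact: cvg_cst | exact: exprS].
Qed.

Lemma near_one_cvg u : near_one u -> u @ \oo --> (1 : V).
Proof.
move=> [C _ uC]; apply/subr_cvg0; apply: cvg_norm_le0 uC _.
rewrite -[X in _ --> X](mulr0 C); apply: cvgM; first exact: cvg_cst.
exact/norm_cvg0P.
Qed.

Lemma near_one_bounded u : near_one u -> exists2 M, 0 < M & forall n, `|u n| <= M.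
Proof. by move=> /near_one_cvg u1; exact: cvgn_norm_bounded (cvgP _ u1). Qed.

Lemma near_oneM u v : near_one u -> near_one v -> near_one (fun n => u n * v n).
Proof.
move=> [C C0 uC] /[dup] /near_one_bounded [M M0 vM] [D D0 vD].
exists (C * M + D); first by rewrite addr_ge0// mulr_ge0// ltW.
move=> n; have -> : u n * v n - 1 = (u n - 1) * v n + (v n - 1).
  by rewrite mulrBl mul1r addrA subrK.
rewrite [leRHS]mulrDl (le_trans (ler_normD _ _))// lerD//.
by rewrite (le_trans (ler_normM _ _))// mulrAC ler_pM.
Qed.

Lemma near_oneS u : near_one u -> near_one (fun n => u n.+1).
Proof.
move=> [C C0 uC]; exists (C * `|Q|); first by rewrite mulr_ge0.
move=> n; apply: le_trans (uC _) _; rewrite exprS -mulrA ler_wpM2l//.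
exact: ler_normM.
Qed.

Lemma near_one_subMX x : near_one (fun n => 1 - x * Q ^+ n).
Proof.
by exists `|x| => // n; rewrite addrAC subrr add0r normrN ler_normM.
Qed.

Lemma near_oneV u : (forall n, u n \is a GRing.unit) -> near_one u ->
  near_one (fun n => (u n)^-1).
Proof.
move=> uU /[dup] /near_one_cvg /(cvg_inv1 uU) /cvgP /cvgn_norm_bounded [M M0 uM].
move=> [C C0 uC]; exists (M * C); first by rewrite mulr_ge0// ltW.
move=> n; have -> : (u n)^-1 - 1 = (u n)^-1 * (1 - u n).
  by rewrite mulrBr mulr1 mulVr.
by rewrite (le_trans (ler_normM _ _))// -mulrA ler_pM// distrC.
Qed.

Lemma near_one_prodr u P : near_one u -> (forall n, P n.+1 = P n * u n) -> cvgn P.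
Proof.
move=> [C C0 uC] PS.
apply: (cvg_product_of_increments (e := C *: (fun n => `|Q ^+ n|))).
- by move=> n; rewrite mulr_ge0.
- move=> n; rewrite PS -[X in _ - X]mulr1 -mulrBr.
  by rewrite (le_trans (ler_normM _ _))// mulrC ler_wpM2r//; exact: uC.
- by apply: is_cvg_seriesZ; exact: cvg_norm_series_expr.
Qed.

Lemma near_one_prodl u P : near_one u -> (forall n, P n.+1 = u n * P n) -> cvgn P.
Proof.
move=> [C C0 uC] PS.
apply: (cvg_product_of_increments (e := C *: (fun n => `|Q ^+ n|))).
- by move=> n; rewrite mulr_ge0.
- move=> n; rewrite PS -[X in _ - X]mul1r -mulrBl.
  by rewrite (le_trans (ler_normM _ _))// ler_wpM2r//; exact: uC.
- by apply: is_cvg_seriesZ; exact: cvg_norm_series_expr.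
Qed.

Lemma cvg_expr_muln n : (fun k => Q ^+ (k * n.+1)) @ \oo --> (0 : V).
Proof.
apply: (cvg_comp (fun k => (k * n.+1)%N) (fun m => Q ^+ m)) Q0.
move=> S [N _ SN]; exists N => // k /= Nk; apply: SN => /=.
by rewrite (leq_trans Nk)// leq_pmulr.
Qed.

Lemma unit_sub1X n : 1 - Q ^+ n.+1 \is a GRing.unit.
Proof.
apply: unit_sub1; rewrite (_ : (fun k => _) = (fun k => Q ^+ (k * n.+1))).
  exact: cvg_expr_muln.
by apply/funext => k; rewrite -exprM mulnC.
Qed.

End NearOne.

(** The closure lemmas of [GRing.comm] split its second argument only; [commute] therefore splits,
    swaps the sides and splits again. *)
Ltac comm_split :=
  repeat first [apply: commr1 | apply: commrB | apply: commrM |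
                apply: commrV | apply: commrX].
Ltac commute :=
  comm_split; apply: commr_sym; comm_split;
  first [assumption | apply: commr_refl | apply: commr_sym; assumption].

(** * Termwise operations on series, and the terms of the type I sum *)

Section SeriesShift.
Variables (R : realType) (V : banachAlgType R).
Implicit Types (u v : nat -> V) (a b l : V).

Lemma cvg_series_shift u : cvgn (series u) ->
  (series (fun n => u n.+1)) @ \oo --> limn (series u) - u 0%N.
Proof.
move=> cu; rewrite [X in X @ _](_ : _ = (fun n => series u n.+1 - u 0%N)).
  apply: cvgB; last exact: cvg_cst.
  by have := cu; rewrite -(cvg_shiftS (series u)).
by apply/funext => n; rewrite !seriesEnat /= big_nat_recl// addrC addKr.
Qed.

Lemma series_mull a u : series (fun n => a * u n) = (fun n => a * series u n).
Proof. by apply/funext => n; rewrite !seriesEnat /= mulr_sumr. Qed.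

Lemma cvg_series_mull a u l : series u @ \oo --> l ->
  series (fun n => a * u n) @ \oo --> a * l.
Proof. by move=> ul; rewrite series_mull; exact: cvg_mull. Qed.

Lemma cvg_series_sub u v a b : series u @ \oo --> a -> series v @ \oo --> b ->
  series (fun n => u n - v n) @ \oo --> a - b.
Proof.
move=> ua vb; rewrite (_ : series _ = (fun n => series u n - series v n)).
  exact: cvgB.
by apply/funext => n; rewrite !seriesEnat /= sumrB.
Qed.

End SeriesShift.

Arguments cvg_series_mull {R V} a {u l} _.

(* [psi_pos n] and [psi_neg n] are the type I terms of index [n] and [-n]; both
   start with the term 1 of index 0. *)
Section Terms.
Variables (V : unitRingType) (A Z Q B : V).

Fixpoint psi_pos n : V :=
  if n is m.+1 then (1 - B * Q ^+ m)^-1 * ((1 - A * Q ^+ m) * Z * psi_pos m)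
  else 1.

Fixpoint psi_neg n : V :=
  if n is m.+1 then
    Z^-1 * (1 - A * Q ^- m.+1)^-1 * (1 - B * Q ^- m.+1) * psi_neg m
  else 1.

End Terms.

(** * The functional equation in B *)

Section FunctionalEquation.
Variables (R : realType) (V : banachAlgType R) (A Z Q : V).
Hypotheses (commQA : GRing.comm Q A) (commQZ : GRing.comm Q Z).
Hypotheses (unitA : A \is a GRing.unit) (unitZ : Z \is a GRing.unit)
  (unitQ : Q \is a GRing.unit).
Hypothesis unitAQ : forall m : nat, 1 - A * Q ^- m.+1 \is a GRing.unit.

Let U := Z^-1 * A^-1.

(** The second series starts at [n.+1] because the term of index 0 is already counted in the
    first. *)
Definition psi B : V :=
  limn (series (psi_pos A Z Q B)) +
  limn (series (fun n => psi_neg A Z Q B n.+1)).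

Lemma psiE B : cvgn (series (psi_neg A Z Q B)) ->
  psi B = limn (series (psi_pos A Z Q B)) +
          (limn (series (psi_neg A Z Q B)) - 1).
Proof. by move=> cN; congr (_ + _); apply: cvg_lim (cvg_series_shift cN). Qed.

Lemma psi_posS B n : 1 - B * Q ^+ n \is a GRing.unit ->
  (1 - B * Q ^+ n) * psi_pos A Z Q B n.+1 =
  (1 - A * Q ^+ n) * Z * psi_pos A Z Q B n.
Proof. by move=> uB; rewrite /= mulVKr. Qed.

Lemma psi_negS B n :
  (1 - A * Q ^- n.+1) * Z * psi_neg A Z Q B n.+1 =
  (1 - B * Q ^- n.+1) * psi_neg A Z Q B n.
Proof. by rewrite /= !mulrA mulrK// mulrV// mul1r. Qed.

Section FixedB.
Variable B : V.
Hypotheses (commBA : GRing.comm B A) (commBZ : GRing.comm B Z)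
  (commBQ : GRing.comm B Q).
Hypothesis unitBQ : forall m : nat, 1 - B * Q ^+ m \is a GRing.unit.

Let unitBQS m : 1 - B * Q * Q ^+ m \is a GRing.unit.
Proof. by rewrite -mulrA -exprS. Qed.

Lemma psi_pos_mulQ n :
  (1 - B) * psi_pos A Z Q B n = (1 - B * Q ^+ n) * psi_pos A Z Q (B * Q) n.
Proof.
elim: n => [|n IH]; first by rewrite expr0 (mulr1 B).
rewrite exprS (mulrA B) psi_posS//; apply: (mulrI (unitBQ n)).
have c1 : GRing.comm (1 - B * Q ^+ n) (1 - B) by commute.
have c2 : GRing.comm (1 - B) ((1 - A * Q ^+ n) * Z) by commute.
have c3 : GRing.comm (1 - B * Q ^+ n) ((1 - A * Q ^+ n) * Z) by commute.
rewrite (mulrA _ (1 - B)) c1 -(mulrA (1 - B)) psi_posS//.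
by rewrite (mulrA (1 - B)) c2 -mulrA IH (mulrA _ (1 - _)) -c3 -(mulrA (1 - _)).
Qed.

Lemma psi_pos_mulQS n : (1 - B) * psi_pos A Z Q B n.+1 =
  (1 - A * Q ^+ n) * Z * psi_pos A Z Q (B * Q) n.
Proof. by rewrite psi_pos_mulQ exprS (mulrA B) psi_posS. Qed.

Let Q_cancel n : Q * Q ^- n.+1 = Q ^- n.
Proof. by rewrite exprSr invrM ?unitrX// mulrA mulrV// mul1r. Qed.

Lemma psi_neg_mulQ n :
  (1 - B) * psi_neg A Z Q B n = (1 - B * Q ^- n) * psi_neg A Z Q (B * Q) n.
Proof.
elim: n => [|n IH]; first by rewrite expr0 invr1 (mulr1 B).
have c1 : GRing.comm (1 - B) ((1 - A * Q ^- n.+1) * Z) by commute.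
have c2 : GRing.comm (1 - B) (1 - B * Q ^- n.+1) by commute.
have c3 : GRing.comm (1 - B * Q ^- n.+1) ((1 - A * Q ^- n.+1) * Z) by commute.
have uAZ : (1 - A * Q ^- n.+1) * Z \is a GRing.unit by rewrite unitrMl.
apply: (mulrI uAZ); rewrite (mulrA _ (1 - B)) -c1 -(mulrA (1 - B)) psi_negS.
rewrite (mulrA (1 - B)) c2 -mulrA IH [RHS](mulrA _ (1 - _)) -c3.
by rewrite -[RHS](mulrA (1 - _)) psi_negS -[B * Q * _]mulrA Q_cancel.
Qed.

(** The relation for t_{k+1} at k = -(n+1), so that k + 1 = -n: [n] and [n.+1] exchange the places
    they have in [psi_pos_mulQS]. *)
Lemma psi_neg_mulQS n : (1 - B) * psi_neg A Z Q B n =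
  (1 - A * Q ^- n.+1) * Z * psi_neg A Z Q (B * Q) n.+1.
Proof. by rewrite psi_neg_mulQ psi_negS -[B * Q * _]mulrA Q_cancel. Qed.

(** Here q = Q^k, x = t_k(B), y = t_{k+1}(B) and s = t_k(BQ). As U A q Z = Z^-1 q Z = q, the two
    terms in q cancel. The remaining coefficient does not depend on k, so the identity can be summed
    over k. *)
Lemma contiguous_terms q x y s : GRing.comm q Z ->
  (1 - B) * x = (1 - B * q) * s -> (1 - B) * y = (1 - A * q) * Z * s ->
  (1 - B) * (x - B * U * y) = (1 - B * U * Z) * s.
Proof.
move=> qZ xs ys; have c : GRing.comm (1 - B) (B * U) by rewrite /U; commute.
rewrite mulrBr xs (mulrA (1 - B)) c -(mulrA (B * U)) ys.
rewrite !mulrBl !mul1r !mulrBr opprB addrA !mulrA.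
rewrite /U -!mulrA (mulKr unitA) (mulrA q) qZ -(mulrA Z) (mulKr unitZ).
by rewrite subrK.
Qed.

Lemma psi_functional_equation :
  cvgn (series (psi_pos A Z Q B)) -> cvgn (series (psi_neg A Z Q B)) ->
  cvgn (series (psi_pos A Z Q (B * Q))) ->
  cvgn (series (psi_neg A Z Q (B * Q))) ->
  (1 - B) * (1 - B * U) * psi B = (1 - B * U * Z) * psi (B * Q).
Proof.
move=> cP cN cP' cN'; rewrite (psiE cN) (psiE cN').
have sP := cvg_series_shift cP; have sN := cvg_series_shift cN.
have sN' := cvg_series_shift cN'.
set P := limn (series (psi_pos A Z Q B)) in sP *.
set N := limn (series (psi_neg A Z Q B)) in sN *.
set P' := limn _; set N' := limn _.
(* The index shift drops the term 1 from one sum in each half, but not from the same one; after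
   adding [eP] and [eN] both combinations equal P + N - 1. *)
have eP : (1 - B) * (P - B * U * (P - 1)) = (1 - B * U * Z) * P'.
  have := cvg_series_mull (1 - B)
    (cvg_series_sub cP (cvg_series_mull (B * U) sP)).
  have -> : (fun n => (1 - B) *
      (psi_pos A Z Q B n - B * U * psi_pos A Z Q B n.+1)) =
      (fun n => (1 - B * U * Z) * psi_pos A Z Q (B * Q) n).
    apply/funext => n; apply: contiguous_terms (psi_pos_mulQ n) (psi_pos_mulQS n).
    by commute.
  move=> lim; apply: cvg_unique lim _; first exact: norm_hausdorff.
  exact: cvg_series_mull cP'.
have eN : (1 - B) * (N - 1 - B * U * N) = (1 - B * U * Z) * (N' - 1).
  have := cvg_series_mull (1 - B)
    (cvg_series_sub sN (cvg_series_mull (B * U) cN)).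
  have -> : (fun n => (1 - B) *
      (psi_neg A Z Q B n.+1 - B * U * psi_neg A Z Q B n)) =
      (fun n => (1 - B * U * Z) * psi_neg A Z Q (B * Q) n.+1).
    apply/funext => n.
    apply: contiguous_terms (psi_neg_mulQ n.+1) (psi_neg_mulQS n).
    by commute.
  move=> lim; apply: cvg_unique lim _; first exact: norm_hausdorff.
  exact: cvg_series_mull sN'.
rewrite [RHS]mulrDr -eP -eN -mulrDr -mulrA; congr (_ * _).
rewrite mulrBl mul1r [RHS]addrACA -opprD -mulrDr; congr (_ - _ * _).
by rewrite addrAC addrA.
Qed.

End FixedB.
End FunctionalEquation.

(** * Finite Pochhammer products *)

Section Pochhammer.
Variables (V : unitRingType) (B Q : V).

Fixpoint poch n : V := if n is m.+1 then (1 - B * Q ^+ m) * poch m else 1.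

(** Kept as a product of inverses so that its convergence follows from [near_one]; [poch_mulV] then
    shows that its limit is inverse to that of [poch]. *)
Fixpoint pochV n : V := if n is m.+1 then (1 - B * Q ^+ m)^-1 * pochV m else 1.

Hypothesis commBQ : GRing.comm B Q.

Lemma comm_poch x n : GRing.comm x B -> GRing.comm x Q -> GRing.comm x (poch n).
Proof.
move=> xB xQ; elim: n => [|n IH] /=; first exact: commr1.
by apply: commrM => //; commute.
Qed.

Lemma comm_pochV x n : GRing.comm x B -> GRing.comm x Q -> GRing.comm x (pochV n).
Proof.
move=> xB xQ; elim: n => [|n IH] /=; first exact: commr1.
by apply: commrM => //; commute.
Qed.

Lemma poch_mulV n : (forall m, 1 - B * Q ^+ m \is a GRing.unit) ->
  poch n * pochV n = 1.
Proof.
move=> unitBQ; elim: n => [|n IH] /=; first by rewrite mulr1.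
have -> : (1 - B * Q ^+ n) * poch n = poch n * (1 - B * Q ^+ n).
  by apply: commr_sym; apply: commr_sym; apply: comm_poch; commute.
by rewrite mulrA mulrK// IH.
Qed.

End Pochhammer.

(** * Convergence of the two halves, and their limits along B Q^N *)

Section Convergence.
Variables (R : realType) (V : banachAlgType R) (A Z Q : V).
Hypotheses (commQA : GRing.comm Q A) (commQZ : GRing.comm Q Z).
Hypotheses (unitA : A \is a GRing.unit) (unitZ : Z \is a GRing.unit)
  (unitQ : Q \is a GRing.unit).
Hypothesis unitAQ : forall m : nat, 1 - A * Q ^- m.+1 \is a GRing.unit.
Hypothesis Q0 : (fun n => Q ^+ n) @ \oo --> (0 : V).
Hypothesis Z0 : (fun n => Z ^+ n) @ \oo --> (0 : V).

Let U := Z^-1 * A^-1.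

Lemma near_one_pochfactor B : (forall m, 1 - B * Q ^+ m \is a GRing.unit) ->
  near_one Q (fun n => (1 - B * Q ^+ n)^-1).
Proof. by move=> uB; apply: near_oneV => //; exact: near_one_subMX. Qed.

(** The ratio of successive terms tends to [Z]. *)
Lemma psi_pos_norm_cvg B : (forall m, 1 - B * Q ^+ m \is a GRing.unit) ->
  cvgn (series (fun n => `|psi_pos A Z Q B n|)).
Proof.
move=> uB.
apply: (contracting_product_cvg
  (u := fun n => (1 - B * Q ^+ n)^-1 * ((1 - A * Q ^+ n) * Z)) _ Z0); last first.
  by move=> n /=; rewrite !mulrA.
rewrite [X in _ --> X](_ : Z = 1 * (1 * Z)); last by rewrite !mul1r.
apply: cvg_mul; first exact: (near_one_cvg Q0 (near_one_pochfactor uB)).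
by apply: cvg_mulr; exact: (near_one_cvg Q0 (near_one_subMX Q A)).
Qed.

Let subA'X n : 1 - A * Q ^- n.+1 = - (A * Q ^- n.+1) * (1 - A^-1 * Q ^+ n.+1).
Proof.
have c : GRing.comm (Q ^- n.+1) A^-1 by commute.
rewrite mulrBr mulr1 mulNr opprK [RHS]addrC; congr (_ - _).
by rewrite mulrA -(mulrA A) c (mulrA A) mulrV// mul1r mulVr// unitrX.
Qed.

Lemma unit_subA'X n : 1 - A^-1 * Q ^+ n.+1 \is a GRing.unit.
Proof.
by have := unitAQ n; rewrite subA'X unitrMr// unitrN unitrMl// unitrV unitrX.
Qed.

(** The growing powers of Q^-1 cancel between numerator and denominator. In this form the ratio
    visibly tends to Z^-1 A^-1 B, that is, to [B * U]. *)
Lemma psi_neg_ratio B n : GRing.comm B Q -> psi_neg A Z Q B n.+1 =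
  Z^-1 * (1 - A^-1 * Q ^+ n.+1)^-1 * A^-1 * (B - Q ^+ n.+1) * psi_neg A Z Q B n.
Proof.
move=> BQ; rewrite /=; congr (_ * _); rewrite -!(mulrA Z^-1); congr (_ * _).
apply: (mulrI (unitAQ n)); rewrite mulVKr// {1}subA'X -!mulrA.
rewrite (mulVKr (unit_subA'X n)).
have c : GRing.comm (Q ^- n.+1) A^-1 by commute.
have c' : GRing.comm (Q ^- n.+1) B by commute.
rewrite mulNr -mulrA (mulrA (Q ^- n.+1)) c -mulrA mulVKr//.
by rewrite mulrBr mulVr ?unitrX// opprB c'.
Qed.

Let near_one_inv_subA' : near_one Q (fun n => (1 - A^-1 * Q ^+ n.+1)^-1).
Proof.
apply: (near_oneV Q0 (u := fun n => 1 - A^-1 * Q ^+ n.+1)).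
  exact: unit_subA'X.
exact: (near_oneS (near_one_subMX Q A^-1)).
Qed.

Let QX0 : (fun n => Q ^+ n.+1) @ \oo --> (0 : V).
Proof. by have := Q0; rewrite -(cvg_shiftS (fun n => Q ^+ n)). Qed.

Lemma psi_neg_norm_cvg B N : GRing.comm B A -> GRing.comm B Z ->
  GRing.comm B Q -> (fun n => (B * U) ^+ n) @ \oo --> (0 : V) ->
  cvgn (series (fun n => `|psi_neg A Z Q (B * Q ^+ N) n|)).
Proof.
move=> BA BZ BQ BU0; have BQQ : GRing.comm (B * Q ^+ N) Q.
  by apply: commr_sym; commute.
have cBU : GRing.comm (B * U) (Q ^+ N) by rewrite /U; commute.
(* The two factors commute, and the powers of [Q ^+ N] are bounded since they are powers of [Q]. *)
have BUQ : (fun n => (B * U * Q ^+ N) ^+ n) @ \oo --> (0 : V).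
  under eq_fun do rewrite exprMn_comm// -exprM.
  have [M M0 QM] := cvgn_norm_bounded (cvgP _ Q0).
  apply: (@cvg_norm_le0 _ _ _ (fun n => `|(B * U) ^+ n| * M)).
    by move=> n; rewrite (le_trans (ler_normM _ _))// ler_wpM2l.
  rewrite -[X in _ --> X](mul0r M); apply: cvgM; last exact: cvg_cst.
  exact/norm_cvg0P.
apply: (contracting_product_cvg (u := fun n => Z^-1 *
  (1 - A^-1 * Q ^+ n.+1)^-1 * A^-1 * (B * Q ^+ N - Q ^+ n.+1)) _ BUQ); last first.
  by move=> n; exact: psi_neg_ratio.
have -> : B * U * Q ^+ N = Z^-1 * 1 * A^-1 * (B * Q ^+ N - 0).
  have c : GRing.comm U B by rewrite /U; commute.
  by rewrite mulr1 subr0 -[B * U]c -(mulrA U).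
apply: cvg_mul.
  by apply: cvg_mulr; apply: cvg_mull; exact: (near_one_cvg Q0 near_one_inv_subA').
by apply: cvgB; [exact: cvg_cst | exact: QX0].
Qed.

(* As both Pochhammer products converge, this bounds the left-hand side uniformly
   in [N]. *)
Lemma psi_pos_poch B N n : GRing.comm B A -> GRing.comm B Z ->
  GRing.comm B Q -> (forall m, 1 - B * Q ^+ m \is a GRing.unit) ->
  psi_pos A Z Q (B * Q ^+ N) n =
  poch B Q N * pochV B Q (N + n) * psi_pos A Z Q 0 n.
Proof.
move=> BA BZ BQ uB; elim: n => [|n IH].
  by rewrite addn0 poch_mulV// !mul1r.
rewrite addnS /= IH mul0r subr0 invr1 mul1r -(mulrA B) -exprD.
have c1 : GRing.comm (1 - B * Q ^+ (N + n))^-1 (poch B Q N).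
  by apply: comm_poch; apply: commr_sym; commute.
have c2 : GRing.comm ((1 - A * Q ^+ n) * Z) (poch B Q N * pochV B Q (N + n)).
  by apply: commrM; [apply: comm_poch | apply: comm_pochV];
    apply: commr_sym; commute.
rewrite (mulrA (_ * Z)) c2 -!(mulrA (poch _ _ _)) [RHS]mulrA.
by rewrite (mulrA _ (poch _ _ _)) c1 -!mulrA.
Qed.

Lemma poch_cvg B : (forall m, 1 - B * Q ^+ m \is a GRing.unit) ->
  cvgn (poch B Q).
Proof. by move=> uB; apply: (near_one_prodl Q0 (near_one_subMX Q B)). Qed.

Lemma pochV_cvg B : (forall m, 1 - B * Q ^+ m \is a GRing.unit) ->
  cvgn (pochV B Q).
Proof. by move=> uB; apply: (near_one_prodl Q0 (near_one_pochfactor uB)). Qed.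

Section Limit.
Variable B : V.
Hypotheses (commBA : GRing.comm B A) (commBZ : GRing.comm B Z)
  (commBQ : GRing.comm B Q).
Hypothesis unitBQ : forall m : nat, 1 - B * Q ^+ m \is a GRing.unit.

Lemma psi_pos_limit :
  cvgn (series (psi_pos A Z Q 0)) /\
  (fun N => limn (series (psi_pos A Z Q (B * Q ^+ N)))) @ \oo -->
    limn (series (psi_pos A Z Q 0)).
Proof.
have unit0Q m : 1 - 0 * Q ^+ m \is a GRing.unit by rewrite mul0r subr0 unitr1.
have [M M0 PM] := cvgn_norm_bounded (poch_cvg unitBQ).
have [M' M'0 PM'] := cvgn_norm_bounded (pochV_cvg unitBQ).
apply: (@tannery _ _ _ ((M * M') *: (fun n => `|psi_pos A Z Q 0 n|)) _ 0%N).
- move=> N n _; rewrite psi_pos_poch//.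
  rewrite (le_trans (ler_normM _ _))// ler_wpM2r//.
  by rewrite (le_trans (ler_normM _ _))// ler_pM.
- by apply: is_cvg_seriesZ; exact: psi_pos_norm_cvg.
(* For fixed n the coefficient in [psi_pos_poch] tends to the product of the two Pochhammer limits,
   which is 1. *)
- move=> n; have e1 : limn (poch B Q) * limn (pochV B Q) = 1.
    rewrite -limn_mul; [|exact: poch_cvg|exact: pochV_cvg].
    by under eq_fun do rewrite poch_mulV//; exact: lim_cst.
  have pVn : (fun N => pochV B Q (N + n)) @ \oo --> limn (pochV B Q).
    by apply: cvg_comp (pochV_cvg unitBQ); exact: cvg_addnr.
  have := cvg_mulr (x := psi_pos A Z Q 0 n) (cvg_mul (poch_cvg unitBQ) pVn).
  rewrite e1 mul1r (_ : (fun N => _) = (fun N => psi_pos A Z Q (B * Q ^+ N) n)).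
    by [].
  by apply/funext => N; rewrite psi_pos_poch.
Qed.

(** In [psi_neg_ratio] at [B * Q ^+ N], the factor [B * Q ^+ N - Q ^+ n.+1] is small when N and n
    are both large, so the ratios have a bound uniform in N >= [N1]. *)
Lemma psi_neg_limit :
  cvgn (series (psi_neg A Z Q 0)) /\
  (fun N => limn (series (psi_neg A Z Q (B * Q ^+ N)))) @ \oo -->
    limn (series (psi_neg A Z Q 0)).
Proof.
have BQ0 : (fun N => B * Q ^+ N) @ \oo --> (0 : V).
  by rewrite -[X in _ --> X](mulr0 B); exact: cvg_mull.
have [M M0 uM] := near_one_bounded Q0 near_one_inv_subA'.
(* [K] bounds the part of the ratio in front of that factor; the added 1 makes it positive. For |B
   Q^N| < [e] the ratio is bounded by [w n], which is at most 2 K e = 1/2 once |Q^(n+1)| < [e]. *)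
pose K := `|Z^-1| * M * `|A^-1| + 1.
have K0 : 0 < K by rewrite ltr_wpDl// !mulr_ge0// ltW.
pose e := (4 * K)^-1; have e0 : 0 < e by rewrite invr_gt0 mulr_gt0.
pose w n := K * (`|Q ^+ n.+1| + e).
have w0 n : 0 <= w n.
  by rewrite mulr_ge0 ?(ltW K0)// addr_ge0// ltW.
pose W := fix W n := if n is m.+1 then w m * W m else `|1 : V|.
have W0 n : 0 <= W n.
  by elim: n => [|n IH]; [exact: normr_ge0 | exact: mulr_ge0].
have /cvgr0Pnorm_lt/(_ _ e0) [N1 _ BQN1] := BQ0.
apply: (@tannery _ _ _ W _ N1).
- move=> N n N1N; elim: n => [//|n IH].
  rewrite psi_neg_ratio; last by apply: commr_sym; commute.
  rewrite (le_trans (ler_normM _ _))//= ler_pM//.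
  rewrite (le_trans (ler_normM _ _))//= ler_pM//.
    rewrite (le_trans (ler_normM _ _))// /K.
    apply: (@le_trans _ _ (`|Z^-1| * M * `|A^-1|)); last by rewrite lerDl.
    rewrite ler_wpM2r// (le_trans (ler_normM _ _))//.
    by rewrite ler_wpM2l.
  rewrite [leRHS]addrC (le_trans (ler_normB _ _))// lerD// ltW//.
  exact: BQN1.
- have /cvgr0Pnorm_lt/(_ _ e0) [n0 _ Qn0] := QX0.
  apply: (@series_halving_cvg _ _ 1 n0) => // n n0n.
  rewrite addn1 /= ler_wpM2r// /w.
  apply: (@le_trans _ _ (K * (e + e))); last first.
    have -> : K * (e + e) = 2^-1 by rewrite /e; field; rewrite gt_eqF.
    by [].
  by rewrite ler_wpM2l ?(ltW K0)// lerD2r ltW//; exact: Qn0.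
- elim=> [|n IH]; first exact: cvg_cst.
  apply: cvg_mul => //; apply: cvg_mull; apply: cvgB; first exact: cvg_cst.
  exact: cvg_mulr.
Qed.

End Limit.
End Convergence.

(** * Evaluation of the type I sum *)

Section Summation.
Variables (R : realType) (V : banachAlgType R) (A Z Q : V).
Hypotheses (commQA : GRing.comm Q A) (commQZ : GRing.comm Q Z).
Hypotheses (unitA : A \is a GRing.unit) (unitZ : Z \is a GRing.unit)
  (unitQ : Q \is a GRing.unit).
Hypothesis unitAQ : forall m : nat, 1 - A * Q ^- m.+1 \is a GRing.unit.
Hypothesis unitZQ : forall m : nat, 1 - Z * Q ^+ m \is a GRing.unit.
Hypothesis Q0 : (fun n => Q ^+ n) @ \oo --> (0 : V).
Hypothesis Z0 : (fun n => Z ^+ n) @ \oo --> (0 : V).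

Let U := Z^-1 * A^-1.
Let commQQ : GRing.comm Q Q := commr_refl Q.

(** Convergence of the negative half is left as a premise because it has two sources: the condition
    on [B * U] for the given B, and termination for B = Q. *)
Lemma psi_limit B : GRing.comm B A -> GRing.comm B Z -> GRing.comm B Q ->
  (forall m, 1 - B * Q ^+ m \is a GRing.unit) ->
  (forall N, cvgn (series (psi_neg A Z Q (B * Q ^+ N)))) ->
  (fun N => psi A Z Q (B * Q ^+ N)) @ \oo --> psi A Z Q 0.
Proof.
move=> BA BZ BQ uB cN.
have [cP0 limP] := psi_pos_limit commQA commQZ Q0 Z0 BA BZ BQ uB.
have [cN0 limN] := psi_neg_limit Z commQA unitA unitQ unitAQ Q0 BQ.
rewrite (psiE cN0) (_ : (fun N => _) =
    (fun N => limn (series (psi_pos A Z Q (B * Q ^+ N))) +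
              (limn (series (psi_neg A Z Q (B * Q ^+ N))) - 1))).
  by apply: cvgD => //; apply: cvgB => //; exact: cvg_cst.
by apply/funext => N; rewrite (psiE (@cN N)).
Qed.

Lemma unit_subQ m : 1 - Q * Q ^+ m \is a GRing.unit.
Proof. by rewrite -exprS; exact: unit_sub1X. Qed.

(** The factor 1 - Q^(N+1) Q^-(N+1) enters at index N + 1 and stays in all later terms. *)
Lemma psi_neg_QX N n : (N < n)%N -> psi_neg A Z Q (Q * Q ^+ N) n = 0.
Proof.
elim: n => // n IH; rewrite ltnS leq_eqVlt => /predU1P[<-|/IH /= ->].
  by rewrite /= -exprS mulrV ?unitrX// subrr mulr0 mul0r.
by rewrite mulr0.
Qed.

Lemma psi_neg_QX_cvg N : cvgn (series (psi_neg A Z Q (Q * Q ^+ N))).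
Proof.
apply: normed_cvg; apply: (@series_halving_cvg _ _ 1 N.+1) => n.
  exact: normr_ge0.
by move=> Nn; rewrite /= !psi_neg_QX ?normr0 ?mulr0// addn1 ltnW.
Qed.

Lemma psi_pos_cvg B : (forall m, 1 - B * Q ^+ m \is a GRing.unit) ->
  cvgn (series (psi_pos A Z Q B)).
Proof. by move=> uB; apply: normed_cvg; exact: psi_pos_norm_cvg. Qed.

(* At [B = Q] all terms of negative index vanish. Replacing [Z] by [Z Q^N] turns
   the sum into [beta N], with [(1 - Z Q^N) beta N = (1 - A Z Q^N) beta (N+1)]
   and [beta N --> 1]. *)
Lemma psi_Q_binomial (K : nat -> V) : K 0%N = 1 ->
  (forall n, K n.+1 = K n * ((1 - Z * Q ^+ n)^-1 * (1 - A * Z * Q ^+ n))) ->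
  cvgn K /\ psi A Z Q Q = limn K.
Proof.
move=> K0 KS; have cK : cvgn K.
  apply: (near_one_prodr Q0 _ KS); apply: near_oneM => //.
    exact: near_one_pochfactor.
  exact: near_one_subMX.
split=> //; pose p := psi_pos A Z Q Q.
have [M M0 QM] := cvgn_norm_bounded (cvgP _ Q0).
pose v N k := Q ^+ (N * k) * p k.
have vp N k : `|v N k| <= M * `|p k|.
  by rewrite (le_trans (ler_normM _ _))// ler_wpM2r.
have cp : cvgn (series (M *: (fun k => `|p k|))).
  by apply: is_cvg_seriesZ; exact: (psi_pos_norm_cvg Q0 Z0 unit_subQ).
have cv N : cvgn (series (v N)) := is_cvg_norm_series (vp N) cp.
pose beta N := limn (series (v N)).
(* The left-hand side contains the factor 1 - Q^(k+1), exactly the denominator that enters at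
   [p k.+1]. *)
have v_rec N k : v N k.+1 - v N.+1 k.+1 =
    Z * Q ^+ N * v N k - A * Z * Q ^+ N * v N.+1 k.
  have c1 m : GRing.comm (Q ^+ m) Z by apply: commr_sym; commute.
  have c2 m : GRing.comm (Q ^+ m) (A * Z) by apply: commr_sym; commute.
  have -> : v N k.+1 - v N.+1 k.+1 =
      Q ^+ (N * k.+1) * ((1 - A * Q ^+ k) * Z * p k).
    rewrite -(psi_posS A Z (unit_subQ k)) -exprS mulrBl mul1r mulrBr.
    rewrite (mulrA _ (Q ^+ k.+1)) -exprD.
    by rewrite addnC -mulSn.
  have -> : Z * Q ^+ N * v N k = Q ^+ (N * k.+1) * (Z * p k).
    by rewrite /v mulrA -(mulrA Z) -exprD -mulnS -c1 mulrA.
  have -> : A * Z * Q ^+ N * v N.+1 k = Q ^+ (N * k.+1) * (A * Q ^+ k * Z * p k).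
    rewrite /v mulrA -(mulrA (A * Z)) -exprD.
    have -> : (N + N.+1 * k = N * k.+1 + k)%N by rewrite mulSn mulnS addnA addnAC.
    rewrite -c2 exprD -!mulrA; congr (_ * _); rewrite !mulrA; congr (_ * _).
    by have -> : GRing.comm (Q ^+ k) A by apply: commr_sym; commute.
  by rewrite -mulrBr !mulrBl mul1r.
have beta_rec N : (1 - Z * Q ^+ N) * beta N = (1 - A * Z * Q ^+ N) * beta N.+1.
  have := cvg_series_sub (cvg_series_shift (cv N)) (cvg_series_shift (cv N.+1)).
  rewrite (funext (v_rec N)) => /cvg_lim e1.
  have := cvg_series_sub (cvg_series_mull (Z * Q ^+ N) (cv N))
    (cvg_series_mull (A * Z * Q ^+ N) (cv N.+1)).
  move=> /cvg_lim; rewrite e1// => /(_ (@norm_hausdorff _ _)).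
  have -> : v N 0%N = v N.+1 0%N by rewrite /v !muln0.
  rewrite opprB addrA subrK -/(beta _) -/(beta _) => e2.
  rewrite !mulrBl !mul1r; apply/eqP.
  by rewrite subr_eq -addrA [- _ + _]addrC -e2 addrC subrK.
have psiQ : psi A Z Q Q = beta 0%N.
  rewrite /psi (_ : (fun n => psi_neg A Z Q Q n.+1) = (fun=> 0)); last first.
    apply/funext => n; have := @psi_neg_QX 0 n.+1 isT.
    by rewrite expr0 mulr1.
  rewrite [X in _ + X](_ : _ = 0); last first.
    apply: cvg_lim => //; rewrite (_ : series _ = (fun=> 0)); first exact: cvg_cst.
    by apply/funext => n; rewrite seriesEnat /= big1.
  rewrite addr0; congr (limn (series _)); apply/funext => k.
  by rewrite /v mul0n expr0 mul1r.
have Kbeta N : K N * beta N = psi A Z Q Q.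
  elim: N => [|N IH]; first by rewrite K0 mul1r psiQ.
  by rewrite KS -(mulrA (K N)) -(mulrA _^-1) -beta_rec mulKr.
have beta1 : beta @ \oo --> (1 : V).
  (* Q^(N k) tends to 0 for k > 0, so only the term of index 0 survives. *)
  pose l k : V := if k is _.+1 then 0 else 1.
  have vl k : v ^~ k @ \oo --> l k.
    case: k => [|k]; rewrite /v /=.
      by under eq_fun do rewrite muln0 expr0 mul1r; exact: cvg_cst.
    rewrite -(mul0r (p k.+1)); apply: cvg_mulr; exact: cvg_expr_muln.
  have [_] := tannery (N1 := 0%N) (fun N n _ => vp N n) cp vl.
  rewrite (_ : limn (series l) = 1)//; apply: cvg_lim => //.
  rewrite -(cvg_shiftS (series l)) (_ : (fun n => _) = (fun=> 1)).
    exact: cvg_cst.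
  apply/funext => n; rewrite seriesEnat /= big_nat_recl// big1 ?addr0//.
have := cvg_mul cK beta1; rewrite mulr1 (funext Kbeta) => /cvg_lim <-//.
by rewrite lim_cst.
Qed.

Lemma psi_step B : GRing.comm B A -> GRing.comm B Z -> GRing.comm B Q ->
  (forall m, 1 - B * Q ^+ m \is a GRing.unit) ->
  cvgn (series (psi_neg A Z Q B)) -> cvgn (series (psi_neg A Z Q (B * Q))) ->
  (1 - B) * (1 - B * U) * psi A Z Q B = (1 - B * U * Z) * psi A Z Q (B * Q).
Proof.
move=> BA BZ BQ uB cN cN'; apply: psi_functional_equation => //.
  exact: psi_pos_cvg.
by apply: psi_pos_cvg => m; rewrite -mulrA -exprS.
Qed.

(** [U * Z] is the conjugate of A^-1 by Z, so this reduces to [unit_subA'X]. *)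
Lemma unit_subUZQ n : 1 - U * Z * Q ^+ n.+1 \is a GRing.unit.
Proof.
have -> : 1 - U * Z * Q ^+ n.+1 = Z^-1 * ((1 - A^-1 * Q ^+ n.+1) * Z).
  have c : GRing.comm (Q ^+ n.+1) Z by apply: commr_sym; commute.
  by rewrite mulrBl mul1r mulrBr mulVr// /U -!mulrA c.
by rewrite unitrMr ?unitrV// unitrMl//; exact: unit_subA'X.
Qed.

Section Limits.
Variable H : nat -> V.
Hypotheses (H0 : H 0%N = 1)
  (HS : forall n, H n.+1 =
    (1 - U * Z * Q ^+ n.+1)^-1 * (1 - U * Q ^+ n.+1) * H n).

(** The functional equation at B = Q^(N+1), solved for f(BQ): the new factor comes on the left, as
    in the recurrence of [H]. *)
Lemma psi_QX N : psi A Z Q (Q * Q ^+ N) = poch Q Q N * H N * psi A Z Q Q.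
Proof.
elim: N => [|N IH]; first by rewrite expr0 mulr1 H0 !mul1r.
have QNA : GRing.comm (Q * Q ^+ N) A by apply: commr_sym; commute.
have QNZ : GRing.comm (Q * Q ^+ N) Z by apply: commr_sym; commute.
have QNQ : GRing.comm (Q * Q ^+ N) Q by apply: commr_sym; commute.
have QU : GRing.comm Q U by rewrite /U; commute.
have qU : Q * Q ^+ N * U = U * Q ^+ N.+1.
  by rewrite exprS; apply: commr_sym; commute.
have qUZ : Q * Q ^+ N * U * Z = U * Z * Q ^+ N.+1.
  by rewrite qU -mulrA -(mulrA U); congr (_ * _); apply: commr_sym; commute.
have := psi_step QNA QNZ QNQ.
rewrite qUZ qU -(mulrA Q) -exprSr.
have uN m : 1 - Q * Q ^+ N * Q ^+ m \is a GRing.unit.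
  by rewrite -mulrA -exprD; exact: unit_subQ.
move=> /(_ uN (@psi_neg_QX_cvg N) (@psi_neg_QX_cvg N.+1)).
rewrite IH => step; apply: (mulrI (unit_subUZQ N)); rewrite -step HS.
have c1 : GRing.comm (1 - U * Z * Q ^+ N.+1) (poch Q Q N.+1).
  by apply: comm_poch; apply: commr_sym; commute.
have c2 : GRing.comm (1 - U * Q ^+ N.+1) (poch Q Q N).
  by apply: comm_poch; apply: commr_sym; commute.
rewrite -!(mulrA (poch _ _ _)) [RHS]mulrA c1 -[RHS]mulrA.
rewrite -[X in _ = _ * (_ * X)]mulrA -[X in _ = _ * (_ * X)]mulrA.
rewrite mulVKr ?unit_subUZQ// /=.
rewrite -(mulrA (1 - _)) -[RHS](mulrA (1 - _)); congr (_ * _).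
by rewrite (mulrA _ (poch _ _ _)) c2 -(mulrA (poch _ _ _)).
Qed.

Lemma psi_0 : cvgn H -> psi A Z Q 0 = limn (poch Q Q) * limn H * psi A Z Q Q.
Proof.
move=> cH; have cP := poch_cvg Q0 unit_subQ.
have lim0 := psi_limit commQA commQZ commQQ unit_subQ
  (fun N => @psi_neg_QX_cvg N).
rewrite -(cvg_lim _ lim0)//; apply: cvg_lim => //.
rewrite (funext psi_QX); apply: cvg_mulr; exact: cvg_mul.
Qed.

Variables (B : V) (L K : nat -> V).
Hypotheses (commBA : GRing.comm B A) (commBZ : GRing.comm B Z)
  (commBQ : GRing.comm B Q).
Hypothesis unitBQ : forall m : nat, 1 - B * Q ^+ m \is a GRing.unit.
Hypothesis unitBUQ : forall m : nat, 1 - B * U * Q ^+ m \is a GRing.unit.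
Hypothesis BU0 : (fun n => (B * U) ^+ n) @ \oo --> (0 : V).
Hypotheses (L0 : L 0%N = 1)
  (LS : forall n, L n.+1 =
    L n * ((1 - B * U * Q ^+ n)^-1 * (1 - B * U * Z * Q ^+ n))).
Hypotheses (K0 : K 0%N = 1)
  (KS : forall n, K n.+1 =
    K n * ((1 - Z * Q ^+ n)^-1 * (1 - A * Z * Q ^+ n))).

Let psi_neg_BX_cvg N : cvgn (series (psi_neg A Z Q (B * Q ^+ N))).
Proof. by apply: normed_cvg; exact: psi_neg_norm_cvg. Qed.

(** The functional equation at B Q^N, solved for f(B Q^N): the new factor comes on the right of [L],
    while (1 - B Q^N)^-1 commutes through to [pochV]. *)
Lemma psi_iterated N :
  psi A Z Q B = L N * pochV B Q N * psi A Z Q (B * Q ^+ N).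
Proof.
elim: N => [|N ->]; first by rewrite expr0 mulr1 L0 !mul1r.
set q := B * Q ^+ N.
have qA : GRing.comm q A by apply: commr_sym; commute.
have qZ : GRing.comm q Z by apply: commr_sym; commute.
have qQ : GRing.comm q Q by apply: commr_sym; commute.
have QU : GRing.comm Q U by rewrite /U; commute.
have BU : GRing.comm B U by rewrite /U; commute.
have qU : q * U = B * U * Q ^+ N.
  have c : GRing.comm (Q ^+ N) U by apply: commr_sym; commute.
  by rewrite /q -(mulrA B) c mulrA.
have qUZ : q * U * Z = B * U * Z * Q ^+ N.
  have c : GRing.comm (Q ^+ N) Z by apply: commr_sym; commute.
  by rewrite qU -(mulrA (B * U)) c mulrA.
have := psi_step qA qZ qQ; rewrite qUZ qU.
have uq m : 1 - q * Q ^+ m \is a GRing.unit by rewrite /q -mulrA -exprD.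
have qS : q * Q = B * Q ^+ N.+1 by rewrite /q -mulrA -exprSr.
rewrite qS => /(_ uq (@psi_neg_BX_cvg N) (@psi_neg_BX_cvg N.+1)) step.
have c1 : GRing.comm (1 - B * U * Q ^+ N) (1 - q).
  by rewrite /q; apply: commr_sym; commute.
have c2 : GRing.comm ((1 - B * U * Q ^+ N)^-1 * (1 - B * U * Z * Q ^+ N))
    (pochV B Q N.+1).
  by apply: comm_pochV; apply: commr_sym; commute.
have c3 : pochV B Q N.+1 = pochV B Q N * (1 - q)^-1.
  by rewrite /= -/q; apply: comm_pochV; apply: commr_sym; commute.
have -> : psi A Z Q q = (1 - q)^-1 * ((1 - B * U * Q ^+ N)^-1 *
    (1 - B * U * Z * Q ^+ N)) * psi A Z Q (B * Q ^+ N.+1).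
  have uq0 : 1 - q \is a GRing.unit by have := uq 0%N; rewrite expr0 mulr1.
  rewrite -[RHS]mulrA -[X in _ = _ * X]mulrA -step -c1.
  by rewrite -(mulrA (1 - _)) mulKr// mulKr.
rewrite LS [LHS]mulrA; congr (_ * _).
by rewrite -[RHS](mulrA (L N)) c2 [LHS]mulrA -(mulrA (L N)) -c3 -mulrA.
Qed.

(** [L], [H] and [K] are given by recurrences rather than as factorials, so that in the opposite
    algebra they can be instantiated with the products of the type II formula. *)
Theorem psi_summation :
  [/\ cvgn (series (psi_pos A Z Q B)),
      cvgn (series (fun n => psi_neg A Z Q B n.+1)),
      cvgn (pochV B Q) & cvgn (poch Q Q)] /\
  [/\ cvgn L, cvgn H, cvgn K & psi A Z Q B =
      limn L * (limn (pochV B Q) * limn (poch Q Q)) * limn H * limn K].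
Proof.
have cN : cvgn (series (psi_neg A Z Q B)).
  by have := @psi_neg_BX_cvg 0; rewrite expr0 mulr1.
have cPV := pochV_cvg Q0 unitBQ; have cP := poch_cvg Q0 unit_subQ.
have cL : cvgn L.
  apply: (near_one_prodr Q0 _ LS); apply: near_oneM => //.
    exact: near_one_pochfactor.
  exact: near_one_subMX.
have cH : cvgn H.
  apply: (near_one_prodl Q0 _ HS); apply: near_oneM => //.
    apply: (near_oneV Q0 unit_subUZQ).
    exact: (near_oneS (near_one_subMX Q (U * Z))).
  exact: (near_oneS (near_one_subMX Q U)).
have [cK psiQ] := psi_Q_binomial K0 KS.
split; split=> //; first exact: psi_pos_cvg.
  exact: cvgP (cvg_series_shift cN).
have -> : limn L * (limn (pochV B Q) * limn (poch Q Q)) * limn H * limn K =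
    limn L * limn (pochV B Q) * psi A Z Q 0 by rewrite psi_0// psiQ !mulrA.
have lim0 := psi_limit commBA commBZ commBQ unitBQ
  (fun N => @psi_neg_BX_cvg N).
have := cvg_mul (cvg_mul cL cPV) lim0; rewrite -(funext psi_iterated).
by move=> /cvg_lim <-//; rewrite lim_cst.
Qed.

End Limits.
End Summation.

(** * The opposite algebra *)

Section OppositeAlgebra.
Variables (R : realType) (V : banachAlgType R).

(** An alias of [V] with the same norm and topology: limits in the opposite algebra are those of [V]
    by conversion, and only products and what is built from them need translation. *)
Definition opp_alg : Type := V.

HB.instance Definition _ :=
  CompleteNormedModule.copy opp_alg (V : completeNormedModType R).

Let opp_mul (x y : opp_alg) : opp_alg := (y : V) * (x : V).

Let opp_mulA : associative opp_mul.
Proof. by move=> x y z; rewrite /opp_mul mulrA. Qed.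

Let opp_mul1r : left_id (1 : V) opp_mul.
Proof. by move=> x; rewrite /opp_mul mulr1. Qed.

Let opp_mulr1 : right_id (1 : V) opp_mul.
Proof. by move=> x; rewrite /opp_mul mul1r. Qed.

Let opp_mulDl : left_distributive opp_mul +%R.
Proof. by move=> x y z; rewrite /opp_mul mulrDr. Qed.

Let opp_mulDr : right_distributive opp_mul +%R.
Proof. by move=> x y z; rewrite /opp_mul mulrDl. Qed.

Let opp_scaleAl (a : R) (x y : opp_alg) :
  a *: opp_mul x y = opp_mul (a *: x) y.
Proof. exact: bscaleAr. Qed.

Let opp_scaleAr (a : R) (x y : opp_alg) :
  a *: opp_mul x y = opp_mul x (a *: y).
Proof. exact: bscaleAl. Qed.

Let opp_one_neq0 : (1 : V) != 0 :> opp_alg.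
Proof. exact: oner_neq0. Qed.

Let opp_norm_mul (x y : opp_alg) : `|opp_mul x y| <= `|x| * `|y|.
Proof. by rewrite mulrC; exact: ler_normM. Qed.

HB.instance Definition _ := @NormedModule_hasBanachMul.Build R opp_alg (1 : V)
  opp_mul opp_mulA opp_mul1r opp_mulr1 opp_mulDl opp_mulDr opp_scaleAl
  opp_scaleAr opp_one_neq0 opp_norm_mul.

Definition oppB : banachAlgType R := opp_alg.

Implicit Types x y B Q : V.

Lemma opp_algM (x y : oppB) : x * y = (y : V) * (x : V).
Proof. by []. Qed.

Lemma opp_unit x : ((x : oppB) \is a GRing.unit) = (x \is a GRing.unit).
Proof.
apply/unitrP/unitrP => -[y [yx xy]]; exists y; split.
- exact: xy.
- exact: yx.
- exact: xy.
- exact: yx.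
Qed.

(** The inverses of the two algebras come from separate choices and are not convertible. Uniqueness
    identifies them on units; elsewhere both return [x]. *)
Lemma opp_inv x : (x : oppB)^-1 = x^-1.
Proof.
have [ux|nux] := boolP (x \is a GRing.unit); last first.
  by rewrite [RHS]invr_out// [LHS]invr_out// opp_unit.
have ux' : (x : oppB) \is a GRing.unit by rewrite opp_unit.
by apply: (mulrI ux); rewrite mulrV//; exact: (mulVr ux').
Qed.

Lemma opp_exp x n : (x : oppB) ^+ n = x ^+ n.
Proof.
by elim: n => [//|n IH]; rewrite [LHS]exprS IH [RHS]exprSr.
Qed.

Lemma opp_comm x y : GRing.comm x y -> GRing.comm (x : oppB) y.
Proof. by move=> xy; apply: commr_sym; exact: xy. Qed.

(** All factors are expressions in the commuting B and Q, so reversing them changes nothing. *)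
Lemma opp_pochV B Q n : GRing.comm B Q ->
  pochV (B : oppB) Q n = pochV B Q n.
Proof.
move=> BQ; elim: n => [//|n IH] /=; rewrite opp_algM.
rewrite IH opp_inv opp_algM opp_exp.
have c : GRing.comm B (Q ^+ n) by commute.
rewrite -c; apply: commr_sym; apply: comm_pochV; apply: commr_sym; commute.
Qed.

Lemma opp_poch B Q n : GRing.comm B Q ->
  poch (B : oppB) Q n = poch B Q n.
Proof.
move=> BQ; elim: n => [//|n IH] /=; rewrite opp_algM.
rewrite IH opp_algM opp_exp.
have c : GRing.comm B (Q ^+ n) by commute.
rewrite -c; apply: commr_sym; apply: comm_poch; apply: commr_sym; commute.
Qed.

End OppositeAlgebra.

(** * Recurrences for the Q-shifted factorials *)

Section QFactorials.
Variable V : unitRingType.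
Implicit Types (A B Q Z : V) (g : int -> V).

(** The factors depend on k - j, so raising k by one shifts every exponent and the new factor
    appears on the left; in [oprod_asc] it appears on the right. *)
Lemma oprod_desc g n : oprod 1 n.+1%:Z (fun j => g (n.+1%:Z - j)) =
  g n * oprod 1 n%:Z (fun j => g (n%:Z - j)).
Proof.
rewrite /oprod !subrK big_ord_recl addr0 intS [1 + _ - 1]addrAC subrr add0r.
by congr (_ * _); apply: eq_bigr.
Qed.

Lemma oprod_asc g n : oprod 1 n.+1%:Z (fun j => g (j - 1)) =
  oprod 1 n%:Z (fun j => g (j - 1)) * g n.
Proof.
by rewrite /oprod !subrK big_ord_recr /= [1 + _ - 1]addrAC subrr add0r.
Qed.

(** The inverted factors have j = 0, -1, ..., -n, so here the exponents rise from -(n+1) to -1; in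
    [oprod_neg_asc] they fall from -1 to -(n+1). *)
Lemma oprod_neg_desc g n : oprod 1 (- n.+1%:Z) (fun j => g (- n.+1%:Z - j)) =
  \prod_(i < n.+1) (g (- n.+1%:Z + i%:Z))^-1.
Proof.
rewrite /oprod subrK /=; apply: eq_bigr => i _; congr (g _)^-1.
by rewrite subrr sub0r opprK.
Qed.

Lemma oprod_neg_asc g n : oprod 1 (- n.+1%:Z) (fun j => g (j - 1)) =
  \prod_(i < n.+1) (g (- i.+1%:Z))^-1.
Proof.
rewrite /oprod subrK /=; apply: eq_bigr => i _; congr (g _)^-1.
by rewrite subrr sub0r intS opprD addrC.
Qed.

Definition qfact_factor r (A B : r.-tuple V) Q Z (e : int) : V :=
  (\prod_(i < r) ((1 - tnth B i * Q ^ e)^-1 * (1 - tnth A i * Q ^ e))) * Z.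

Lemma qfact_factor1 A B Q Z e : qfact_factor [tuple A] [tuple B] Q Z e =
  (1 - B * Q ^ e)^-1 * (1 - A * Q ^ e) * Z.
Proof. by rewrite /qfact_factor big_ord1 !(tnth_nth 0). Qed.

Lemma qfactI_recr A B Q Z n : qfactI [tuple A] [tuple B] Q Z n.+1 =
  (1 - B * Q ^+ n)^-1 * (1 - A * Q ^+ n) * Z * qfactI [tuple A] [tuple B] Q Z n.
Proof.
by have := oprod_desc (qfact_factor [tuple A] [tuple B] Q Z) n;
  rewrite qfact_factor1.
Qed.

Lemma qfactII_recr A B Q Z n : qfactII [tuple A] [tuple B] Q Z n.+1 =
  qfactII [tuple A] [tuple B] Q Z n *
  ((1 - B * Q ^+ n)^-1 * (1 - A * Q ^+ n) * Z).
Proof.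
by have := oprod_asc (qfact_factor [tuple A] [tuple B] Q Z) n;
  rewrite qfact_factor1.
Qed.

Lemma qfactII2_recr A A' B B' Q n :
  qfactII [tuple A; A'] [tuple B; B'] Q 1 n.+1 =
  qfactII [tuple A; A'] [tuple B; B'] Q 1 n *
  ((1 - B * Q ^+ n)^-1 * (1 - A * Q ^+ n) *
   ((1 - B' * Q ^+ n)^-1 * (1 - A' * Q ^+ n))).
Proof.
have := oprod_asc (qfact_factor [tuple A; A'] [tuple B; B'] Q 1) n.
by rewrite {3}/qfact_factor big_ord_recl big_ord1 !(tnth_nth 0) mulr1.
Qed.

Lemma rev_qfactII_recr A B Q n : rev_qfactII [tuple A] [tuple B] Q 1 n.+1 =
  (1 - A * Q ^+ n) * (1 - B * Q ^+ n)^-1 * rev_qfactII [tuple A] [tuple B] Q 1 n.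
Proof.
have := oprod_desc (fun e => 1 * \prod_(i < 1)
  ((1 - tnth [tuple A] i * Q ^ e) * (1 - tnth [tuple B] i * Q ^ e)^-1)) n.
by rewrite [X in _ = X * _ -> _]mul1r big_ord1 !(tnth_nth 0).
Qed.

Lemma qfactI_pos A B Q Z n :
  qfactI [tuple A] [tuple B] Q Z n%:Z = psi_pos A Z Q B n.
Proof.
elim: n => [|n IH]; last by rewrite qfactI_recr IH /= -!mulrA.
by rewrite /qfactI /oprod subrK big_ord0.
Qed.

Section Negative.
Variables A B Q Z : V.
Hypothesis unitZ : Z \is a GRing.unit.
Hypothesis unitAQ : forall m : nat, 1 - A * Q ^- m.+1 \is a GRing.unit.
Hypothesis unitBQ : forall m : nat, 1 - B * Q ^- m.+1 \is a GRing.unit.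

Let factorV n : (qfact_factor [tuple A] [tuple B] Q Z (- n.+1%:Z))^-1 =
  Z^-1 * (1 - A * Q ^- n.+1)^-1 * (1 - B * Q ^- n.+1).
Proof.
rewrite qfact_factor1 -(mulrA (1 - _)^-1).
have uA : 1 - A * Q ^ (- n.+1%:Z) \is a GRing.unit by exact: unitAQ.
have uB : 1 - B * Q ^ (- n.+1%:Z) \is a GRing.unit by exact: unitBQ.
by rewrite invrM ?unitrV ?unitrMl// invrK invrM.
Qed.

Lemma qfactI_neg n :
  qfactI [tuple A] [tuple B] Q Z (- n.+1%:Z) = psi_neg A Z Q B n.+1.
Proof.
rewrite [LHS](oprod_neg_desc (qfact_factor [tuple A] [tuple B] Q Z) n).
elim: n => [|n IH]; first by rewrite big_ord1 addr0 factorV /= mulr1.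
rewrite big_ord_recl addr0 factorV.
rewrite -[RHS]/(Z^-1 * (1 - A * Q ^- n.+2)^-1 * (1 - B * Q ^- n.+2) *
  psi_neg A Z Q B n.+1) -IH.
by congr (_ * _); apply: eq_bigr.
Qed.

Lemma qfactII_neg_recr n :
  \prod_(i < n.+1) (qfact_factor [tuple A] [tuple B] Q Z (- i.+1%:Z))^-1 =
  (\prod_(i < n) (qfact_factor [tuple A] [tuple B] Q Z (- i.+1%:Z))^-1) *
  (Z^-1 * (1 - A * Q ^- n.+1)^-1 * (1 - B * Q ^- n.+1)).
Proof. by rewrite big_ord_recr /= factorV. Qed.

End Negative.
End QFactorials.

Section Preliminaries.
Variables (R : realType) (V : banachAlgType R).
Implicit Types A B Q Z x : V.

Lemma expr_cvg0 x : `|x| < 1 -> (fun n => x ^+ n) @ \oo --> (0 : V).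
Proof.
(* The factor |1| is there because the norm of the identity is not normalized. *)
move=> x1; apply: (@cvg_norm_le0 _ _ _ (fun n => `|1 : V| * `|x| ^+ n)).
  elim=> [|n IH]; first by rewrite !expr0 mulr1.
  by rewrite exprSr (le_trans (ler_normM _ _))// exprSr mulrA ler_wpM2r.
rewrite -[X in _ --> X](mulr0 `|1 : V|); apply: cvgM; first exact: cvg_cst.
by apply: cvg_expr; rewrite normr_id.
Qed.

(** Separates the commuting factors in B and Q from the genuinely noncommutative ones, to match the
    grouping of [psi_summation]. *)
Lemma product_poch (l G : nat -> V) B Q : GRing.comm B Q ->
  (forall n, GRing.comm B (l n)) -> (forall n, GRing.comm Q (l n)) ->
  G 0%N = 1 ->
  (forall n, G n.+1 = G n * ((1 - B * Q ^+ n)^-1 * (1 - Q * Q ^+ n) * l n)) ->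
  forall n, G n = (\prod_(i < n) l i) * (pochV B Q n * poch Q Q n).
Proof.
move=> BQ Bl Ql G0 GS; elim=> [|n IH]; first by rewrite big_ord0 !mul1r.
have QQ := commr_refl Q; have Bln := Bl n; have Qln := Ql n.
have lP : GRing.comm (l n) (pochV B Q n.+1 * poch Q Q n.+1).
  by apply: commrM; [apply: comm_pochV | apply: comm_poch]; apply: commr_sym.
have bPV : GRing.comm (1 - B * Q ^+ n)^-1 (pochV B Q n).
  by apply: comm_pochV; apply: commr_sym; commute.
have bcP : GRing.comm ((1 - B * Q ^+ n)^-1 * (1 - Q * Q ^+ n)) (poch Q Q n).
  by apply: comm_poch; apply: commr_sym; commute.
rewrite GS IH big_ord_recr /= -[RHS]mulrA.
rewrite [X in _ = _ * X]lP -[LHS]mulrA; congr (_ * _).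
rewrite [LHS]mulrA; congr (_ * _) => /=.
by rewrite bPV -[RHS]mulrA (mulrA (1 - _)^-1) bcP !mulrA.
Qed.

End Preliminaries.

(** * The type I formula *)

Section TypeI.
Variables (R : realType) (V : banachAlgType R) (A B Z Q : V).
Hypotheses (commQA : GRing.comm Q A) (commQZ : GRing.comm Q Z)
  (commBA : GRing.comm B A) (commBZ : GRing.comm B Z) (commBQ : GRing.comm B Q).
Hypotheses (unitA : A \is a GRing.unit) (unitZ : Z \is a GRing.unit)
  (unitQ : Q \is a GRing.unit).
Hypothesis unitBQ : forall m : int, 1 - B * Q ^ m \is a GRing.unit.
Hypothesis unitAQ : forall m : nat, 1 - A * Q ^- m.+1 \is a GRing.unit.
Hypothesis unitZQ : forall m : nat, 1 - Z * Q ^+ m \is a GRing.unit.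
Let U := Z^-1 * A^-1.
Hypothesis unitBUQ : forall m : nat, 1 - B * U * Q ^+ m \is a GRing.unit.
Hypothesis Q0 : (fun n : nat => Q ^+ n) @ \oo --> (0 : V).
Hypothesis Z0 : (fun n => Z ^+ n) @ \oo --> (0 : V).
Hypothesis BU0 : (fun n => (B * U) ^+ n) @ \oo --> (0 : V).

Let unitBQ_nat (m : nat) : 1 - B * Q ^+ m \is a GRing.unit.
Proof. exact: (unitBQ m%:Z). Qed.

Let unitBQ_neg (m : nat) : 1 - B * Q ^- m.+1 \is a GRing.unit.
Proof. exact: (unitBQ (- m.+1%:Z)). Qed.

Lemma psi11I_product :
  [/\ cvg_bilateral (qfactI [tuple A] [tuple B] Q Z),
      cvg_infty (qfactII [tuple Q; B * U * Z] [tuple B; B * U] Q 1),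
      cvg_infty (qfactI [tuple U * Q] [tuple U * Z * Q] Q 1),
      cvg_infty (qfactII [tuple A * Z] [tuple Z] Q 1) &
      psi11I A B Q Z =
        at_infty (qfactII [tuple Q; B * U * Z] [tuple B; B * U] Q 1) *
        at_infty (qfactI [tuple U * Q] [tuple U * Z * Q] Q 1) *
        at_infty (qfactII [tuple A * Z] [tuple Z] Q 1)].
Proof.
pose l (i : nat) := (1 - B * U * Q ^+ i)^-1 * (1 - B * U * Z * Q ^+ i).
pose L (n : nat) := \prod_(i < n) l i.
pose H (n : nat) := qfactI [tuple U * Q] [tuple U * Z * Q] Q 1 n%:Z.
pose K (n : nat) := qfactII [tuple A * Z] [tuple Z] Q 1 n%:Z.
have H0 : H 0%N = 1 by rewrite /H /qfactI /oprod subrK big_ord0.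
have HS n : H n.+1 = (1 - U * Z * Q ^+ n.+1)^-1 * (1 - U * Q ^+ n.+1) * H n.
  by rewrite /H qfactI_recr mulr1 -!(mulrA _ Q) -exprS.
have K0 : K 0%N = 1 by rewrite /K /qfactII /oprod subrK big_ord0.
have KS n : K n.+1 = K n * ((1 - Z * Q ^+ n)^-1 * (1 - A * Z * Q ^+ n)).
  by rewrite /K qfactII_recr mulr1.
have L0 : L 0%N = 1 by rewrite /L big_ord0.
have LS n : L n.+1 = L n * ((1 - B * U * Q ^+ n)^-1 * (1 - B * U * Z * Q ^+ n)).
  by rewrite /L big_ord_recr.
have [[cP cN cPV cPQ] [cL cH cK psiE]] := psi_summation commQA commQZ unitA unitZ
  unitQ unitAQ unitZQ Q0 Z0 H0 HS commBA commBZ commBQ unitBQ_nat unitBUQ BU0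
  L0 LS K0 KS.
have EG : (fun n : nat => qfactII [tuple Q; B * U * Z] [tuple B; B * U] Q 1 n%:Z) =
    (fun n => L n * (pochV B Q n * poch Q Q n)).
  apply/funext; apply: product_poch => //.
  - by move=> n; rewrite /l /U; commute.
  - by move=> n; rewrite /l /U; commute.
  - by rewrite /qfactII /oprod subrK big_ord0.
  - by move=> n; rewrite qfactII2_recr.
have cPP := is_cvg_mul cPV cPQ.
have EP : (fun n : nat => qfactI [tuple A] [tuple B] Q Z n%:Z) = psi_pos A Z Q B.
  by apply/funext => n; exact: qfactI_pos.
have EN : (fun n : nat => qfactI [tuple A] [tuple B] Q Z (- n.+1%:Z)) =
    (fun n => psi_neg A Z Q B n.+1).
  by apply/funext => n; exact: qfactI_neg.
split=> //.
- by rewrite /cvg_bilateral EP EN.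
- by rewrite /cvg_infty EG; exact: is_cvg_mul.
- rewrite /psi11I /bilateral_sum EP EN -/(psi _ _ _ _) psiE.
  by rewrite /at_infty EG limn_mul// limn_mul.
Qed.

End TypeI.

Section OppositeTerms.
Variables (R : realType) (V : banachAlgType R).
Implicit Types x y : V.

Lemma opp_sub1X x y n : 1 - (x : oppB V) * (y : oppB V) ^+ n = 1 - y ^+ n * x.
Proof. by rewrite opp_algM opp_exp. Qed.

Lemma opp_sub1VX x y n : 1 - (x : oppB V) * (y : oppB V) ^- n = 1 - y ^- n * x.
Proof. by rewrite opp_algM opp_inv opp_exp. Qed.

End OppositeTerms.

(** * The type II formula, through the opposite algebra *)

Section TypeII.
Variables (R : realType) (V : banachAlgType R) (A B Z Q : V).
Hypotheses (commQA : GRing.comm Q A) (commQZ : GRing.comm Q Z)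
  (commBA : GRing.comm B A) (commBZ : GRing.comm B Z) (commBQ : GRing.comm B Q).
Hypotheses (unitA : A \is a GRing.unit) (unitZ : Z \is a GRing.unit)
  (unitQ : Q \is a GRing.unit).
Hypothesis unitBQ : forall m : int, 1 - B * Q ^ m \is a GRing.unit.
Hypothesis unitAQ : forall m : nat, 1 - A * Q ^- m.+1 \is a GRing.unit.
Hypothesis unitZQ : forall m : nat, 1 - Z * Q ^+ m \is a GRing.unit.
Let U := Z^-1 * A^-1.
Hypothesis unitBUQ : forall m : nat, 1 - B * U * Q ^+ m \is a GRing.unit.
Hypothesis Q0 : (fun n : nat => Q ^+ n) @ \oo --> (0 : V).
Hypothesis Z0 : (fun n => Z ^+ n) @ \oo --> (0 : V).
Hypothesis BU0 : (fun n => (B * U) ^+ n) @ \oo --> (0 : V).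

Let unitBQ_nat (m : nat) : 1 - B * Q ^+ m \is a GRing.unit.
Proof. exact: (unitBQ m%:Z). Qed.

Let unitBQ_neg (m : nat) : 1 - B * Q ^- m.+1 \is a GRing.unit.
Proof. exact: (unitBQ (- m.+1%:Z)). Qed.

Let W := oppB V.

(* Type II terms for [A] are type I terms for [A'] in the opposite algebra, and
   [U] is the same element for both. *)
Let A' : V := Z^-1 * A * Z.

Let unitA' : A' \is a GRing.unit.
Proof. by rewrite /A' unitrMl// unitrMl// unitrV. Qed.

Let A'V : A'^-1 = U * Z.
Proof.
by rewrite /A' invrM ?unitrMl ?unitrV// invrM ?unitrV// invrK mulrA.
Qed.

Let UE : A'^-1 * Z^-1 = U.
Proof. by rewrite A'V mulrK. Qed.

Let ZU : Z * U = A^-1.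
Proof. by rewrite /U mulVKr. Qed.

Let ZA' : Z * A' = A * Z.
Proof. by rewrite /A' -mulrA mulVKr. Qed.

Let opp_U : (Z : W)^-1 * (A' : W)^-1 = U :> V.
Proof. by rewrite !opp_inv opp_algM UE. Qed.

(** Reversal puts Z in front of the factor, whereas a type II term has it behind; as Z A' = A Z,
    moving Z across turns [A'] back into [A]. *)
Let factor_conj x : GRing.comm x A -> GRing.comm x Z ->
  Z * (1 - x * A') = (1 - A * x) * Z.
Proof.
move=> xA xZ; rewrite mulrBr mulrBl mulr1 mul1r (mulrA Z) -xZ -(mulrA x) ZA'.
by rewrite mulrA xA.
Qed.

Let unit_factor x : GRing.comm x A -> GRing.comm x Z ->
  (1 - x * A' \is a GRing.unit) = (1 - A * x \is a GRing.unit).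
Proof.
by move=> xA xZ; rewrite -[LHS](unitrMr _ unitZ) factor_conj// unitrMl.
Qed.

Let factor_conjV x : GRing.comm x A -> GRing.comm x Z ->
  1 - A * x \is a GRing.unit ->
  (1 - x * A')^-1 * Z^-1 = Z^-1 * (1 - A * x)^-1.
Proof.
move=> xA xZ u; rewrite -!invrM ?unit_factor//.
by rewrite factor_conj.
Qed.

Lemma opp_psi_pos n :
  psi_pos (A' : W) (Z : W) Q B n = qfactII [tuple A] [tuple B] Q Z n%:Z.
Proof.
elim: n => [|n IH]; first by rewrite /qfactII /oprod subrK big_ord0.
rewrite qfactII_recr -IH /= opp_inv !opp_sub1X !opp_algM.
have c1 : GRing.comm (Q ^+ n) B by apply: commr_sym; commute.
have c2 : GRing.comm (Q ^+ n) Z by apply: commr_sym; commute.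
have c3 : GRing.comm (1 - B * Q ^+ n)^-1 ((1 - A * Q ^+ n) * Z) by commute.
have c4 : GRing.comm (Q ^+ n) A by apply: commr_sym; commute.
by rewrite c1 factor_conj// -[LHS]mulrA -c3 !mulrA.
Qed.

Lemma opp_psi_neg n : psi_neg (A' : W) (Z : W) Q B n.+1 =
  qfactII [tuple A] [tuple B] Q Z (- n.+1%:Z).
Proof.
rewrite [RHS](oprod_neg_asc (qfact_factor [tuple A] [tuple B] Q Z) n).
elim: (n.+1) => [|m IH]; first by rewrite big_ord0.
rewrite qfactII_neg_recr// -IH /= !opp_sub1VX !opp_inv !opp_algM.
have c1 : GRing.comm (Q ^- m.+1) B by apply: commr_sym; commute.
have c2 : GRing.comm (Q ^- m.+1) Z by apply: commr_sym; commute.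
have c3 : GRing.comm (1 - B * Q ^- m.+1) (Z^-1 * (1 - A * Q ^- m.+1)^-1).
  by commute.
have c4 : GRing.comm (Q ^- m.+1) A by apply: commr_sym; commute.
by rewrite c1 factor_conjV// c3.
Qed.

(** [psi_summation] read backwards: hence the order [K], [H], [L] and the reversed factorials at
    both ends. In the opposite algebra U Z and B U Z become A^-1 and B A^-1. *)
Lemma psi11II_product :
  [/\ cvg_bilateral (qfactII [tuple A] [tuple B] Q Z),
      cvg_infty (rev_qfactII [tuple A * Z] [tuple Z] Q 1),
      cvg_infty (qfactII [tuple U * Q; Q] [tuple B; A^-1 * Q] Q 1),
      cvg_infty (rev_qfactII [tuple B * A^-1] [tuple B * U] Q 1) &
      psi11II A B Q Z =
        at_infty (rev_qfactII [tuple A * Z] [tuple Z] Q 1) *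
        at_infty (qfactII [tuple U * Q; Q] [tuple B; A^-1 * Q] Q 1) *
        at_infty (rev_qfactII [tuple B * A^-1] [tuple B * U] Q 1)].
Proof.
have cQX x n : GRing.comm Q x -> GRing.comm (Q ^+ n) x.
  by move=> Qx; apply: commr_sym; commute.
have QU : GRing.comm Q U by rewrite /U; commute.
have BU : GRing.comm B U by rewrite /U; commute.
have QQ := commr_refl Q.
pose h (i : nat) := (1 - U * Q ^+ i.+1) * (1 - A^-1 * Q ^+ i.+1)^-1.
pose H (n : nat) := \prod_(i < n) h i.
pose L (n : nat) := rev_qfactII [tuple B * A^-1] [tuple B * U] Q 1 n%:Z.
pose K (n : nat) := rev_qfactII [tuple A * Z] [tuple Z] Q 1 n%:Z.
have H0 : H 0%N = 1 by rewrite /H big_ord0.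
have L0 : L 0%N = 1 by rewrite /L /rev_qfactII /oprod subrK big_ord0.
have K0 : K 0%N = 1 by rewrite /K /rev_qfactII /oprod subrK big_ord0.
(* Copies typed in [W], so that the products below are formed in the opposite algebra. *)
pose A'W : W := A'; pose ZW : W := Z; pose QW : W := Q; pose BW : W := B.
pose UW : W := ZW^-1 * A'W^-1.
pose HW : nat -> W := H; pose LW : nat -> W := L; pose KW : nat -> W := K.
have UWE : UW = U by exact: opp_U.
have UZW : UW * ZW = A^-1 :> V by rewrite UWE opp_algM ZU.
have BUW : BW * UW = B * U :> V by rewrite UWE opp_algM BU.
have BUZW : BW * UW * ZW = B * A^-1 :> V.
  by rewrite -mulrA UZW opp_algM; apply: commr_sym; commute.
have HS n : HW n.+1 = (1 - UW * ZW * QW ^+ n.+1)^-1 * (1 - UW * QW ^+ n.+1) * HW n.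
  rewrite UZW UWE opp_inv !opp_sub1X !opp_algM /HW /H big_ord_recr /= /h.
  by rewrite !cQX//; commute.
have LS n : LW n.+1 =
    LW n * ((1 - BW * UW * QW ^+ n)^-1 * (1 - BW * UW * ZW * QW ^+ n)).
  rewrite BUZW BUW opp_inv !opp_sub1X !opp_algM /LW /L rev_qfactII_recr.
  by rewrite !cQX//; commute.
have KS n : KW n.+1 =
    KW n * ((1 - ZW * QW ^+ n)^-1 * (1 - A'W * ZW * QW ^+ n)).
  rewrite opp_inv !opp_sub1X !opp_algM ZA' /KW /K rev_qfactII_recr.
  by rewrite !cQX//; commute.
have QA' : GRing.comm Q A' by rewrite /A'; commute.
have BA' : GRing.comm B A' by rewrite /A'; commute.
have uA'W : A'W \is a GRing.unit by rewrite opp_unit.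
have uZW : ZW \is a GRing.unit by rewrite opp_unit.
have uQW : QW \is a GRing.unit by rewrite opp_unit.
have uAQW m : 1 - A'W * QW ^- m.+1 \is a GRing.unit.
  rewrite opp_sub1VX opp_unit unit_factor//; apply: commr_sym; commute.
have uZQW m : 1 - ZW * QW ^+ m \is a GRing.unit.
  by rewrite opp_sub1X opp_unit cQX.
have uBQW m : 1 - BW * QW ^+ m \is a GRing.unit.
  by rewrite opp_sub1X opp_unit cQX//; apply: commr_sym.
have uBUQW m : 1 - BW * UW * QW ^+ m \is a GRing.unit.
  by rewrite BUW opp_sub1X opp_unit cQX//; commute.
have QW0 : (fun n => QW ^+ n) @ \oo --> (0 : W).
  by rewrite (funext (opp_exp Q)); exact: Q0.
have ZW0 : (fun n => ZW ^+ n) @ \oo --> (0 : W).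
  by rewrite (funext (opp_exp Z)); exact: Z0.
have BUW0 : (fun n => (BW * UW) ^+ n) @ \oo --> (0 : W).
  by rewrite BUW (funext (opp_exp (B * U))); exact: BU0.
have [[cP cN cPV cPQ] [cL cH cK psiE]] := psi_summation (opp_comm QA')
  (opp_comm commQZ) uA'W uZW uQW uAQW uZQW QW0 ZW0 H0 HS (opp_comm BA')
  (opp_comm commBZ) (opp_comm commBQ) uBQW uBUQW BUW0 L0 LS K0 KS.
have EPV : pochV BW QW = pochV B Q :> (nat -> V).
  by apply/funext => n; exact: opp_pochV.
have EPQ : poch QW QW = poch Q Q :> (nat -> V).
  by apply/funext => n; exact: opp_poch.
rewrite EPV EPQ in cPV cPQ psiE.
have EM : (fun n : nat => qfactII [tuple U * Q; Q] [tuple B; A^-1 * Q] Q 1 n%:Z) =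
    (fun n => H n * (pochV B Q n * poch Q Q n)).
  apply/funext; apply: product_poch => //.
  - by move=> n; rewrite /h; commute.
  - by move=> n; rewrite /h; commute.
  - by rewrite /qfactII /oprod subrK big_ord0.
  - move=> n; rewrite qfactII2_recr -(mulrA U) -(mulrA A^-1) -(exprS Q n).
    (* The factorial has 1 - Q^(n+1) last; it must pass [h n] to join (1 - B Q^n)^-1. *)
    have c : GRing.comm (1 - Q ^+ n.+1) (h n) by rewrite /h; commute.
    by rewrite -[X in _ = _ * X]mulrA c /h !mulrA.
have EP : psi_pos A'W ZW QW BW =
    (fun n : nat => qfactII [tuple A] [tuple B] Q Z n%:Z) :> (nat -> V).
  by apply/funext => n; exact: opp_psi_pos.
have EN : (fun n => psi_neg A'W ZW QW BW n.+1) =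
    (fun n : nat => qfactII [tuple A] [tuple B] Q Z (- n.+1%:Z)) :> (nat -> V).
  by apply/funext => n; exact: opp_psi_neg.
rewrite EP in cP; rewrite EN in cN.
have cH' : cvgn H by exact: cH.
have cPV' : cvgn (pochV B Q) by exact: cPV.
have cPQ' : cvgn (poch Q Q) by exact: cPQ.
have cPP := is_cvg_mul cPV' cPQ'.
split.
- by split; [exact: cP | exact: cN].
- exact: cK.
- by rewrite /cvg_infty EM; exact: (is_cvg_mul cH' cPP).
- exact: cL.
(* Reversal also swaps the two Pochhammer limits; their factors commute, so the order can be
   restored. *)
- have cc : limn (poch Q Q) * limn (pochV B Q) =
      limn (pochV B Q) * limn (poch Q Q).
    rewrite -(limn_mul cPQ' cPV') -(limn_mul cPV' cPQ').
    congr (limn _); apply/funext => n.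
    apply: comm_pochV; apply: commr_sym; last by apply: comm_poch.
    by apply: comm_poch.
  have EMl : limn (fun n : nat =>
      qfactII [tuple U * Q; Q] [tuple B; A^-1 * Q] Q 1 n%:Z) =
      limn H * (limn (pochV B Q) * limn (poch Q Q)).
    by rewrite EM -(limn_mul cPV' cPQ'); exact: (limn_mul cH' cPP).
  move: psiE; rewrite /psi EP EN => psiE.
  rewrite !opp_algM in psiE.
  have psiEV : psi11II A B Q Z = limn K * (limn H *
      (limn (poch Q Q) * limn (pochV B Q) * limn L)) := psiE.
  rewrite psiEV /at_infty EMl -cc -/K -/L.
  rewrite -[RHS]mulrA -[in RHS]mulrA.
  reflexivity.
Qed.

End TypeII.

Theorem theorem3p2 (R : realType) (V : banachAlgType R) (A B Z Q : V)
  (commQA : GRing.comm Q A) (commQB : GRing.comm Q B) (commQZ : GRing.comm Q Z)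
  (commBA : GRing.comm B A) (commBZ : GRing.comm B Z)
  (unitA : A \is a GRing.unit) (unitZ : Z \is a GRing.unit)
  (unitQ : Q \is a GRing.unit)
  (unitBQ : forall m : int, 1 - B * Q ^ m \is a GRing.unit)
  (unitAQ : forall m : nat, 1 - A * Q ^ (- m.+1%:Z) \is a GRing.unit)
  (unitZQ : forall m : nat, 1 - Z * Q ^ m%:Z \is a GRing.unit)
  (unitBZAQ : forall m : nat, 1 - B * Z^-1 * A^-1 * Q ^ m%:Z \is a GRing.unit)
  (cvgQ : (fun n : nat => Q ^+ n) @ \oo --> (0 : V))
  (normZ : `|Z| < 1) (normBZA : `|B * Z^-1 * A^-1| < 1) :
  [/\ cvg_bilateral (qfactI [tuple A] [tuple B] Q Z),
      cvg_infty (qfactII [tuple Q; B * Z^-1 * A^-1 * Z]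
                         [tuple B; B * Z^-1 * A^-1] Q 1),
      cvg_infty (qfactI [tuple Z^-1 * A^-1 * Q] [tuple Z^-1 * A^-1 * Z * Q] Q 1),
      cvg_infty (qfactII [tuple A * Z] [tuple Z] Q 1) &
      psi11I A B Q Z =
        at_infty (qfactII [tuple Q; B * Z^-1 * A^-1 * Z]
                          [tuple B; B * Z^-1 * A^-1] Q 1) *
        at_infty (qfactI [tuple Z^-1 * A^-1 * Q]
                         [tuple Z^-1 * A^-1 * Z * Q] Q 1) *
        at_infty (qfactII [tuple A * Z] [tuple Z] Q 1)] /\
  [/\ cvg_bilateral (qfactII [tuple A] [tuple B] Q Z),
      cvg_infty (rev_qfactII [tuple A * Z] [tuple Z] Q 1),
      cvg_infty (qfactII [tuple Z^-1 * A^-1 * Q; Q] [tuple B; A^-1 * Q] Q 1),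
      cvg_infty (rev_qfactII [tuple B * A^-1] [tuple B * Z^-1 * A^-1] Q 1) &
      psi11II A B Q Z =
        at_infty (rev_qfactII [tuple A * Z] [tuple Z] Q 1) *
        at_infty (qfactII [tuple Z^-1 * A^-1 * Q; Q] [tuple B; A^-1 * Q] Q 1) *
        at_infty (rev_qfactII [tuple B * A^-1] [tuple B * Z^-1 * A^-1] Q 1)].
Proof.
have commBQ := commr_sym commQB.
have BUE : B * Z^-1 * A^-1 = B * (Z^-1 * A^-1) by rewrite mulrA.
rewrite BUE in unitBZAQ normBZA *.
have Z0 := expr_cvg0 normZ; have BU0 := expr_cvg0 normBZA.
split.
  exact: (psi11I_product commQA commQZ commBA commBZ commBQ unitA unitZ unitQ
    unitBQ unitAQ unitZQ unitBZAQ cvgQ Z0 BU0).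
exact: (psi11II_product commQA commQZ commBA commBZ commBQ unitA unitZ unitQ
  unitBQ unitAQ unitZQ unitBZAQ cvgQ Z0 BU0).
Qed.
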